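(* Let $G$ be a locally compact abelian group and let $(g_k)_{k\ge1}$ be a sequence of elements of $G$. Suppose that $$\frac1N\sum_{k=1}^N\chi(g_k)\to0\quad(N\to+\infty)$$ for all continuous characters $\chi$ of $G$ except at most countably many. Let $Q=\{g_k;\,k\ge1\}$. If $Q$ generates $G$, then $Q$ is a Kazhdan set in $G$. Without assuming that $Q$ generates $G$: for every increasing sequence $(W_n)_{n\ge1}$ of subsets of $G$ with $\bigcup_{n\ge1}W_n=G$, there exists $n\ge1$ such that $W_n\cup Q$ is a Kazhdan set in $G$.
   Context: A character of $G$ is a continuous homomorphism $G\to\mathbb T=\{z\in\mathbb C:|z|=1\}$. All Hilbert spaces are complex; unitary representations are strongly continuous. A subset $Q\subseteq G$ is a Kazhdan set in $G$ if there exists $\varepsilon>0$ such that every unitary representation $\pi$ of $G$ having a vector $x$ with $\sup_{g\in Q}\|\pi(g)x-x\|<\varepsilon\|x\|$ has a non-zero $G$-invariant vector. $Q$ generates $G$ if the smallest subgroup of $G$ containing $Q$ is $G$. *)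

(* Defs.v *)
(* MathComp + MathComp-Analysis; complex numbers from mathcomp-real-closed. *)
From mathcomp Require Import all_boot all_order all_algebra.
From mathcomp Require Import all_classical all_reals all_analysis.
From mathcomp Require Export complex.
Set Implicit Arguments. Unset Strict Implicit. Unset Printing Implicit Defensive.
Import Order.TTheory GRing.Theory Num.Theory.
Local Open Scope ring_scope.
Local Open Scope complex_scope.
Local Open Scope classical_set_scope.

Section Defs.
Variable R : realType.
Local Notation C := (R[i]).

(** Continuous characters of a topological abelian group G:
    continuous homomorphisms G -> T = {z in C : |z| = 1}. *)
Definition is_character (G : topologicalZmodType) (chi : G -> C) : Prop :=
  (forall x, `|chi x| = 1) /\
  (forall x y, chi (x + y) = chi x * chi y) /\
  (forall (x0 : G) (e : R), 0 < e ->
     \forall x \near x0, `|chi x - chi x0| < e%:C).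

(** The Cesaro means (1/N) sum_{k=1}^N chi(g_k) tend to 0
    (the sequence (g_k)_{k>=1} is stored as g : nat -> G with g_k = g (k-1)). *)
Definition cesaro_to_0 (G : topologicalZmodType) (g : nat -> G) (chi : G -> C)
  : Prop :=
  forall e : R, 0 < e -> exists N0 : nat, forall N : nat, (N0 <= N)%N ->
    `|(N%:R)^-1 * \sum_(k < N) chi (g k)| < e%:C.

(** Inner product (linear in the first variable) on a complex vector space. *)
Definition is_inner_product (V : lmodType C) (ip : V -> V -> C) : Prop :=
  (forall x y z, ip (x + y) z = ip x z + ip y z) /\
  (forall (a : C) x y, ip (a *: x) y = a * ip x y) /\
  (forall x y, ip y x = (ip x y)^*) /\
  (forall x, 0 <= ip x x) /\
  (forall x, ip x x = 0 -> x = 0).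

Definition ipnorm (V : lmodType C) (ip : V -> V -> C) (x : V) : R :=
  Num.sqrt (complex.Re (ip x x)).

(** Completeness with respect to the inner-product norm. *)
Definition ip_complete (V : lmodType C) (ip : V -> V -> C) : Prop :=
  forall u : nat -> V,
    (forall e : R, 0 < e -> exists N, forall m n, (N <= m)%N -> (N <= n)%N ->
        ipnorm ip (u m - u n) < e) ->
    exists l : V, forall e : R, 0 < e -> exists N, forall n, (N <= n)%N ->
        ipnorm ip (u n - l) < e.

(** Complex Hilbert space structure on V. *)
Definition is_hilbert (V : lmodType C) (ip : V -> V -> C) : Prop :=
  is_inner_product ip /\ ip_complete ip.

(** Strongly continuous unitary representation of G on (V, ip). *)
Definition is_unitary_rep (G : topologicalZmodType) (V : lmodType C)
  (ip : V -> V -> C) (pi : G -> V -> V) : Prop :=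
  (forall g (a : C) x y, pi g (a *: x + y) = a *: pi g x + pi g y) /\
  (forall g x y, ip (pi g x) (pi g y) = ip x y) /\
  (forall g y, exists x, pi g x = y) /\
  (forall x, pi 0 x = x) /\
  (forall g h x, pi (g + h) x = pi g (pi h x)) /\
  (forall (x : V) (g0 : G) (e : R), 0 < e ->
     \forall g \near g0, ipnorm ip (pi g x - pi g0 x) < e).

(** Kazhdan set: there is eps > 0 such that every unitary representation
    having a vector x with sup_{g in Q} ||pi(g)x - x|| < eps ||x||
    has a non-zero invariant vector.  "sup < c" is written as: there is
    d < c bounding all the ||pi(g)x - x||, g in Q. *)
Definition kazhdan_set (G : topologicalZmodType) (Q : set G) : Prop :=
  exists eps : R, 0 < eps /\
    forall (V : lmodType C) (ip : V -> V -> C) (pi : G -> V -> V),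
      is_hilbert ip -> is_unitary_rep ip pi ->
      forall x : V,
        (exists d : R, d < eps * ipnorm ip x /\
           forall g, Q g -> ipnorm ip (pi g x - x) <= d) ->
        exists v : V, v <> 0 /\ forall g, pi g v = v.

End Defs.

(** Q generates G: the smallest subgroup of G containing Q is G. *)
Definition generates (G : zmodType) (Q : set G) : Prop :=
  forall S : set G, S 0 -> (forall x y, S x -> S y -> S (x - y)) ->
    Q `<=` S -> S = setT.

(* Main.v *)
(* A finite-dimensional shadow of the spectral theorem: for finitely many
   elements of G, iterated discrete Fourier transforms split a vector into
   approximate joint eigenvectors of the commuting unitaries, i.e. give a finite
   measure on functions G -> T.  Ultralimits of such measures are finitely
   additive contents on functions G -> T, concentrated on homomorphisms.

   A content under which (1) the points of a neighbourhood of 0 act on average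
   almost trivially, (2) no e_j is charged, and (3) the Cesaro means stay away
   from 0 with probability >= theta for infinitely many N, produces a continuous
   character outside (e_j) whose Cesaro means do not tend to 0: compactness of
   the set of all functions G -> T gives the homomorphism, and a local form of
   Folner's condition, which replaces Haar measure and is where local
   compactness enters, makes it continuous.  Hence, under the hypothesis on
   (g_k), the averages (1/N) sum pi(g_k) y tend to 0 for every y orthogonal to
   all e_j-eigenvectors.

   If no W_n u Q is a Kazhdan set, almost invariant vectors in representations
   without invariant vectors are therefore close to sums of eigenvectors for
   nontrivial e_j, and so define finitely supported probability measures m_n on
   nontrivial characters with E_{m_n} |X(u) - 1| <= 2^-n for u in W_n u Q; by
   Baire's theorem this also holds, up to a constant, on a neighbourhood of 0.
   A product of independent random characters with laws m_n (n growing fast),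
   where the l-th factor is used only to move away from e_l, has a law which
   contradicts the previous paragraph. *)
Require Import Defs.
From mathcomp Require Import all_boot all_order all_algebra.
From mathcomp Require Import all_classical all_reals all_analysis.
From mathcomp Require Import complex cyclic separable cyclotomic ring lra.
Import Order.TTheory GRing.Theory Num.Theory.
Import numFieldNormedType.Exports.
Local Open Scope ring_scope.
Local Open Scope complex_scope.
Local Open Scope classical_set_scope.
Set Implicit Arguments. Unset Strict Implicit. Unset Printing Implicit Defensive.

(** * The complex modulus with values in [R] *)

Section Cmod.
Variable R : realType.
Implicit Types x y z : R[i].

(** The norm of [R[i]] takes values in [R[i]]; a version with values in [R] allows order arithmetic
    in the real field. *)
Definition cmod z : R := complex.Re `|z|.

Lemma normC_cmod z : `|z| = (cmod z)%:C.
Proof. by rewrite /cmod RRe_real // normr_real. Qed.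

Lemma cmod_ge0 z : 0 <= cmod z.
Proof. by rewrite -lecR -normC_cmod normr_ge0. Qed.

Lemma cmodM x y : cmod (x * y) = cmod x * cmod y.
Proof. by apply: complexI; rewrite rmorphM /= -!normC_cmod normrM. Qed.

Lemma cmodX z n : cmod (z ^+ n) = cmod z ^+ n.
Proof. by apply: complexI; rewrite rmorphXn /= -!normC_cmod normrX. Qed.

Lemma cmodD x y : cmod (x + y) <= cmod x + cmod y.
Proof. by rewrite -lecR rmorphD /= -!normC_cmod ler_normD. Qed.

Lemma cmodN x : cmod (- x) = cmod x.
Proof. by rewrite /cmod normrN. Qed.

Lemma cmodC x y : cmod (x - y) = cmod (y - x).
Proof. by rewrite -cmodN opprB. Qed.

Lemma cmod_tri x y z : cmod (x - z) <= cmod (x - y) + cmod (y - z).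
Proof. by rewrite -[X in cmod X](subrKA y) ?cmodD // addrC; apply: cmodD. Qed.

Lemma cmodB x y : cmod (x - y) <= cmod x + cmod y.
Proof. by rewrite -[cmod y]cmodN cmodD. Qed.

Lemma cmod0 : cmod 0 = 0.
Proof. by rewrite /cmod normr0. Qed.

Lemma cmod1 : cmod 1 = 1.
Proof. by rewrite /cmod normr1. Qed.

Lemma cmod_real (r : R) : cmod r%:C = `|r|.
Proof. by rewrite /cmod normc_def /= expr0n /= addr0 sqrtr_sqr. Qed.

Lemma cmod_conj z : cmod z^*%C = cmod z.
Proof. by rewrite /cmod normcJ. Qed.

Lemma cmod_nat n : cmod n%:R = n%:R.
Proof.
by rewrite -[n%:R in LHS](rmorph_nat (real_complex R)) cmod_real ger0_norm ?ler0n.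
Qed.

Lemma cmodV z : cmod z^-1 = (cmod z)^-1.
Proof. by apply: complexI; rewrite fmorphV /= -!normC_cmod normfV. Qed.

Lemma cmod_eq0 z : cmod z = 0 -> z = 0.
Proof.
by move=> z0; apply/eqP; rewrite -normr_eq0 normC_cmod z0 rmorph0.
Qed.

Lemma cmod_sum (I : finType) (P : pred I) (f : I -> R[i]) :
  cmod (\sum_(i | P i) f i) <= \sum_(i | P i) cmod (f i).
Proof.
elim/big_rec2: _ => [|i a b _ le_ba]; first by rewrite cmod0.
by rewrite (le_trans (cmodD _ _)) // lerD2l.
Qed.

Lemma cmodRe z : `|complex.Re z| <= cmod z.
Proof. by rewrite -lecR -normC_cmod normc_ge_Re. Qed.

Lemma cmodIm z : `|complex.Im z| <= cmod z.
Proof.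
rewrite -normrN -ReiNIm (le_trans (cmodRe _)) // cmodM.
by rewrite {2}/cmod normc_def /= expr0n expr1n add0r sqrtr1 mulr1.
Qed.

Lemma conjcM x y : (x * y)^*%C = x^*%C * y^*%C.
Proof. exact: rmorphM. Qed.

Lemma sqr_cmod z : ((cmod z) ^+ 2)%:C = z * z^*%C.
Proof. by rewrite rmorphXn /= -normC_cmod sqr_normc. Qed.

Lemma conj_unit z : cmod z = 1 -> z * z^*%C = 1.
Proof. by move=> z1; rewrite -sqr_cmod z1 expr1n. Qed.

Lemma conj_inv z : cmod z = 1 -> z^*%C = z^-1.
Proof.
move=> z1; have zz := conj_unit z1.
have z0 : z != 0 by apply: contra_eq_neq z1 => ->; rewrite cmod0 eq_sym oner_neq0.
by apply: (mulfI z0); rewrite zz divff.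
Qed.

Lemma cmod_ReIm z : cmod z <= `|complex.Re z| + `|complex.Im z|.
Proof.
rewrite {1}(complexE z) (le_trans (cmodD _ _)) // cmodM !cmod_real.
by rewrite {1}/cmod normc_def /= expr0n expr1n add0r sqrtr1 mul1r.
Qed.

End Cmod.

(** * Finitely supported measures *)

Section FiniteMeasures.
Variable R : realType.

(** Weighted families rather than functions on [X]: points may repeat, [X] needs no decidable
    equality, and products and mixtures are formed on the index types. *)
Record fmeas (X : Type) := FMeas {
  fm_idx : finType; fm_wt : fm_idx -> R; fm_pt : fm_idx -> X }.

Arguments fm_wt {X} f i : rename.
Arguments fm_pt {X} f i : rename.

Variable X : Type.
Implicit Types (m : fmeas X) (f : X -> R) (A B : set X).

Definition fm_prob m := (forall i, 0 <= fm_wt m i) /\ \sum_i fm_wt m i = 1.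
Definition fm_E m f : R := \sum_i fm_wt m i * f (fm_pt m i).
Definition fm_C m (f : X -> R[i]) : R[i] := \sum_i (fm_wt m i)%:C * f (fm_pt m i).
Definition fm_P m A : R := fm_E m (fun x => `[< A x >]%:R).

Lemma fm_E_le m f g : fm_prob m -> (forall i, f (fm_pt m i) <= g (fm_pt m i)) ->
  fm_E m f <= fm_E m g.
Proof. by move=> [w0 _] fg; apply: ler_sum => i _; rewrite ler_wpM2l. Qed.

Lemma fm_E_cst m c : fm_prob m -> fm_E m (fun=> c) = c.
Proof. by move=> [_ w1]; rewrite /fm_E -mulr_suml w1 mul1r. Qed.

Lemma fm_E_ge0 m f : fm_prob m -> (forall x, 0 <= f x) -> 0 <= fm_E m f.
Proof. by move=> mp f0; rewrite -(fm_E_cst 0 mp) fm_E_le. Qed.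

Lemma fm_ED m f g : fm_E m (fun x => f x + g x) = fm_E m f + fm_E m g.
Proof. by rewrite -big_split; apply: eq_bigr => i _; rewrite mulrDr. Qed.

Lemma fm_EZ m c f : fm_E m (fun x => c * f x) = c * fm_E m f.
Proof. by rewrite mulr_sumr; apply: eq_bigr => i _; rewrite mulrCA. Qed.

Lemma fm_C_cmod m (f : X -> R[i]) : fm_prob m ->
  cmod (fm_C m f) <= fm_E m (fun x => cmod (f x)).
Proof.
move=> [w0 _]; rewrite (le_trans (cmod_sum _ _)) // ler_sum // => i _.
by rewrite cmodM cmod_real ger0_norm.
Qed.

Lemma fm_C_cst m c : fm_prob m -> fm_C m (fun=> c) = c.
Proof. by move=> [_ w1]; rewrite /fm_C -mulr_suml -rmorph_sum w1 mul1r. Qed.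

Lemma fm_CB m (f g : X -> R[i]) : fm_C m f - fm_C m g = fm_C m (fun x => f x - g x).
Proof. by rewrite -sumrB; apply: eq_bigr => i _; rewrite mulrBr. Qed.

Lemma fm_E_sqr m f : fm_prob m -> fm_E m f ^+ 2 <= fm_E m (fun x => f x ^+ 2).
Proof.
move=> mp; set e := fm_E m f.
have : 0 <= fm_E m (fun x => (f x - e) ^+ 2).
  by apply: fm_E_ge0 => // x; rewrite sqr_ge0.
have -> : fm_E m (fun x => (f x - e) ^+ 2) =
   fm_E m (fun x => f x ^+ 2) + ((- 2 * e) * e + e ^+ 2).
  transitivity (fm_E m (fun x => f x ^+ 2 + (- 2 * e * f x + e ^+ 2))).
    by apply: eq_bigr => i _; congr (_ * _); ring.
  by rewrite !fm_ED (fm_EZ m) (fm_E_cst _ mp).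
lra.
Qed.

Lemma fm_P_le m A B : fm_prob m -> A `<=` B -> fm_P m A <= fm_P m B.
Proof.
move=> mp AB; apply: fm_E_le => // i; rewrite ler_nat.
by case: asboolP => // /AB Bi; rewrite (asboolT Bi).
Qed.

Lemma fm_P_ge0 m A : fm_prob m -> 0 <= fm_P m A.
Proof. by move=> mp; apply: fm_E_ge0. Qed.

Lemma fm_P_le1 m A : fm_prob m -> fm_P m A <= 1.
Proof.
move=> mp; rewrite -(fm_E_cst 1 mp); apply: fm_E_le => // i.
by case: asboolP.
Qed.

Lemma fm_PU m A B : fm_prob m -> fm_P m (A `|` B) <= fm_P m A + fm_P m B.
Proof.
move=> mp; rewrite -fm_ED; apply: fm_E_le => // i; rewrite asbool_or.
by case: asboolP; case: asboolP => /=; rewrite -?natrD ?ler_nat.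
Qed.

Lemma fm_P_disj m A B : fm_prob m -> A `&` B = set0 ->
  fm_P m A + fm_P m B <= fm_P m (A `|` B).
Proof.
move=> mp AB0; rewrite -fm_ED; apply: fm_E_le => // i; rewrite asbool_or.
have [Ai|_] := asboolP (A _); have [Bi|_] := asboolP (B _);
  rewrite /= -?natrD ?ler_nat //.
by have : (A `&` B) (fm_pt m i) by []; rewrite AB0.
Qed.

Lemma fm_markov m A f c : fm_prob m -> (forall x, 0 <= f x) ->
  (forall i, A (fm_pt m i) -> c <= f (fm_pt m i)) -> c * fm_P m A <= fm_E m f.
Proof.
move=> mp f0 Af; rewrite -fm_EZ; apply: fm_E_le => // i.
by case: asboolP => [/Af|_]; rewrite ?mulr1 ?mulr0.
Qed.

End FiniteMeasures.

Arguments fm_wt {R X} f i : rename.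
Arguments fm_pt {R X} f i : rename.

(** * Folner families and separated families in abelian groups *)

Section Folner.
Variables (R : realType) (G : zmodType).

(** Induction on [F]: the family for the tail is spread along a progression of length [N] in the new
    direction [a]. A shift by [a] telescopes to two end terms, of size at most [2 * B], small
    against [N]; a shift by an earlier [h] is handled by the induction hypothesis applied to the
    translates of [X], which obey the same bound. *)
Lemma folner (F : seq G) (e : R) : 0 < e ->
  exists (I : finType) (s : I -> G), (0 < #|I|)%N /\
    forall h, h \in F -> forall (B : R) (X : G -> R[i]),
      (forall g, cmod (X g) <= B) ->
      cmod (\sum_i (X (s i + h) - X (s i))) <= e * B * #|I|%:R.
Proof.
move=> e0; elim: F => [|a F [I [s [I0 sP]]]].
  by exists unit, (fun=> 0); rewrite card_unit; split => // h; rewrite in_nil.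
pose N := (Num.truncn (2 / e)).+1.
have eN : 2 <= e * N%:R.
  by rewrite mulrC -ler_pdivrMr // ltW // truncnS_gt.
exists (I * 'I_N)%type, (fun p : I * 'I_N => s p.1 + a *+ p.2).
rewrite card_prod card_ord muln_gt0 I0; split => // h.
rewrite in_cons => /orP[/eqP->|hF] B X XB.
  have B0 : 0 <= B by apply: le_trans (XB 0); apply: cmod_ge0.
  rewrite -(pair_big xpredT xpredT (fun i (k : 'I_N) =>
     X (s i + a *+ k + a) - X (s i + a *+ k))) /=.
  apply: (@le_trans _ _ (\sum_(i : I) (e * B * N%:R))); last first.
    by rewrite sumr_const -(mulr_natr _ #|I|) natrM -!mulrA [N%:R * _]mulrC.
  rewrite (le_trans (cmod_sum _ _)) // ler_sum // => i _.
  rewrite (eq_bigr (fun k : 'I_N => X (s i + a *+ k.+1) - X (s i + a *+ k))).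
    rewrite -(big_mkord xpredT (fun k => X (s i + a *+ k.+1) - X (s i + a *+ k))).
    rewrite (telescope_sumr (fun k => X (s i + a *+ k))) // mulr0n addr0.
    rewrite (le_trans (cmodB _ _)) // (le_trans (lerD (XB _) (XB _))) //.
    by rewrite mulrAC -mulr2n -(mulr_natl B 2) ler_wpM2r.
  by move=> k _; rewrite -addrA mulrSr.
rewrite -(pair_big xpredT xpredT (fun i (k : 'I_N) =>
     X (s i + a *+ k + h) - X (s i + a *+ k))) /= exchange_big /=.
rewrite (le_trans (cmod_sum _ _)) //.
rewrite natrM mulrA mulr_natr -[X in _ *+ X]card_ord -sumr_const ler_sum // => k _.
have := sP h hF B (fun g => X (g + a *+ k)) (fun g => XB _).
by under eq_bigr do rewrite addrAC.
Qed.

(** Greedy choice: a point [p] that no [t] serves contributes [- p], since [- p + p = 0] lies in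
    [D]; being unserved is exactly what separates [- p] from the earlier elements. *)
Lemma separated_cover (D : set G) (P : seq G) : D 0 -> (forall g, D g -> D (- g)) ->
  exists T : seq G, [/\ uniq T,
    forall p, p \in P -> exists2 t, t \in T & D (t + p) &
    forall t t', t \in T -> t' \in T -> D (t - t') -> t = t'].
Proof.
move=> D0 DN; elim: P => [|p P [T [uT Tc Ts]]]; first by exists [::].
have [[t tT tp]|nT] := pselect (exists2 t, t \in T & D (t + p)).
  exists T; split => // q; rewrite in_cons => /orP[/eqP->|/Tc//]; by exists t.
have pT : - p \notin T.
  by apply/negP => pT; apply: nT; exists (- p) => //; rewrite addNr.
exists (- p :: T); split => /=; first by rewrite pT.
- move=> q; rewrite in_cons => /orP[/eqP->|/Tc[t tT tq]].
    by exists (- p); rewrite ?mem_head // addNr.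
  by exists t => //; rewrite in_cons tT orbT.
- move=> t t'; rewrite !in_cons => /orP[/eqP->|tT] /orP[/eqP->|tT'] // h.
  + case: nT; exists t' => //.
    by have := DN _ h; rewrite opprB addrC opprK addrC.
  + by case: nT; exists t => //; rewrite opprK in h.
  + exact: Ts.
Qed.

End Folner.

(** * Neighbourhoods of 0, finite covers and sumsets *)

Section Nbhs0.
Variable G : topologicalZmodType.
Implicit Types (D V : set G).

Lemma nbhs0_symm D : nbhs 0 D ->
  exists V, [/\ nbhs 0 V, V 0, forall v, V v -> V (- v) &
    forall u v, V u -> V v -> D (u + v)].
Proof.
move=> D0.
have : nbhs ((0, 0) : G * G) ((fun x => x.1 + x.2) @^-1` D).
  by apply: (@add_continuous G); rewrite /= addr0.
case=> -[A B] /= [nA nB] AB.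
have nS (S : set G) : nbhs 0 S -> nbhs 0 (-%R @^-1` S).
  by move=> nS; apply: (@opp_continuous G); rewrite oppr0.
pose V := (A `&` B) `&` (-%R @^-1` (A `&` B)).
have nV : nbhs 0 V by apply: filterI; [|apply: nS]; apply: filterI.
exists V; split => //; first exact: nbhs_singleton.
  by move=> v [vS vN]; split => //=; rewrite opprK.
by move=> u v [[uA _] _] [[_ vB] _]; apply: (AB (u, v)).
Qed.

Lemma nbhs_shift D g : nbhs 0 D -> nbhs g (fun x => D (x - g)).
Proof.
move=> D0; have cB : (fun x : G => x - g) @ g --> (0 : G).
  rewrite -[X in _ --> X](subrr g).
  apply: (@continuous_comp G (G * G)%type G (fun x => (x, g)) (fun x => x.1 - x.2)).
    by apply: cvg_pair => /=; [exact: cvg_id|exact: cvg_cst].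
  exact: sub_continuous.
exact: cB.
Qed.

Lemma nbhs_unshift D g : nbhs g D -> nbhs 0 (fun x => D (x + g)).
Proof.
move=> D0; have cB : (fun x : G => x + g) @ (0 : G) --> g.
  rewrite -[X in _ --> X](add0r g).
  apply: (@continuous_comp G (G * G)%type G (fun x => (x, g)) (fun x => x.1 + x.2)).
    by apply: cvg_pair => /=; [exact: cvg_id|exact: cvg_cst].
  exact: add_continuous.
exact: cB.
Qed.

(** Otherwise the uncovered parts of [K] generate a proper filter on [K]; a cluster point [p]
    contradicts the choice [Z = [:: p]]. *)
Lemma compact_cover_translates (K D : set G) : compact K -> nbhs 0 D ->
  exists Z : seq G, forall x, K x -> exists2 z, z \in Z & D (x - z).
Proof.
move=> cK nD; apply: contrapT => nZ.
pose rest (Z : seq G) := K `&` [set x | forall z, z \in Z -> ~ D (x - z)].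
pose F : set_system G := [set A | exists Z, rest Z `<=` A].
have FP : ProperFilter F.
  apply: Build_ProperFilter_ex.
    move=> A [Z ZA]; apply: contrapT => nA; apply: nZ; exists Z => x Kx.
    apply: contrapT => nx; apply: nA; exists x; apply: ZA; split => // z zZ Dz.
    by apply: nx; exists z.
  split; first by exists [::].
    move=> A B [Z ZA] [Z' ZB]; exists (Z ++ Z') => x [Kx xZ]; split.
      by apply: ZA; split => // z zZ; apply: xZ; rewrite mem_cat zZ.
    by apply: ZB; split => // z zZ; apply: xZ; rewrite mem_cat zZ orbT.
  by move=> A B AB [Z ZA]; exists Z; apply: subset_trans AB.
have FK : F K by exists [::] => x [].
have [p [_ clp]] := cK F FP FK.
have Fp : F (rest [:: p]) by exists [:: p].
have [x [[_ xp] Dx]] := clp _ _ Fp (nbhs_shift p nD).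
by apply: (xp p) => //; rewrite mem_head.
Qed.

(** The [n]-fold sumset of [V]. It serves for small neighbourhoods here, and at the end for words of
    length [n] in a generating set. *)
Fixpoint nsum V n : set G :=
  if n is n'.+1 then [set g | exists u v, [/\ nsum V n' u, V v & g = u + v]]
  else [set 0].

Lemma nbhs0_nsum n D : nbhs 0 D ->
  exists V, [/\ nbhs 0 V, V 0, forall v, V v -> V (- v) &
    forall j, (j <= n)%N -> nsum V j `<=` D].
Proof.
elim: n D => [|n IHn] D nD.
  have [V [nV V0 VN _]] := nbhs0_symm nD.
  exists V; split => // j; rewrite leqn0 => /eqP-> x ->; exact: nbhs_singleton nD.
have [D1 [nD1 D10 D1N D1D]] := nbhs0_symm nD.
have [V [nV V0 VN VD]] := IHn _ nD1.
pose V' := V `&` D1.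
have V'V : forall j, nsum V' j `<=` nsum V j.
  elim=> //= j IHj g [u [v [/IHj uV [vV _] ->]]]; by exists u, v.
exists V'; split => //.
- exact: filterI.
- by move=> v [/VN ? /D1N ?]; split.
- case=> [_ x ->|j /= jn g [u [v [/V'V/VD uD [_ vD] ->]]]].
    exact: nbhs_singleton nD.
  by apply: D1D => //; apply: uD.
Qed.

End Nbhs0.

(** * A local Reiter condition *)

Section Reiter.
Variables (R : realType) (G : topologicalZmodType).
Hypothesis G_lc : locally_compact [set: G].

Section Layers.
Variables (D V : set G) (n : nat).
Hypothesis V0 : V 0.

Definition layer j : set G := [set g | exists d w, [/\ D d, nsum V j w & g = d + w]].
(** A discrete tent function: it equals [n] on [D], vanishes outside the sets [D + nsum V j] with
    [j < n], and varies by at most 1 under translation by a symmetric [V]. *)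
Definition height g : nat := \sum_(j < n) `[< layer j g >].

Lemma layerS j g h : layer j g -> V h -> layer j.+1 (g + h).
Proof.
move=> [d [w [Dd wV ->]]] Vh; exists d, (w + h); split => //; last by rewrite addrA.
by exists w, h.
Qed.

Lemma layer0 j g : D g -> layer j g.
Proof.
move=> Dg; exists g, 0; split => //; last by rewrite addr0.
by elim: j => //= j IHj; exists 0, 0; split => //; rewrite addr0.
Qed.

Lemma height_le g : (height g <= n)%N.
Proof.
rewrite -[X in (_ <= X)%N]card_ord -sum1_card leq_sum // => j _.
by case: asboolP.
Qed.

Lemma height_full g : D g -> height g = n.
Proof.
move=> Dg; rewrite -[RHS]card_ord -sum1_card; apply: eq_bigr => j _.
by rewrite asboolT //; apply: layer0.
Qed.

Lemma height_shift g h : V h -> (height g <= (height (g + h)%R).+1)%N.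
Proof.
rewrite /height => Vh; case: n => [|m]; first by rewrite big_ord0.
rewrite big_ord_recr big_ord_recl /=.
set a := \sum_(i < m) _; set b := \sum_(i < m) _.
have ab : (a <= b)%N.
  rewrite leq_sum // => j _; case: asboolP => // jg.
  by rewrite asboolT //; apply: layerS.
case: asboolP => _; case: asboolP => _; rewrite ?addn0 ?addn1 ?add0n ?add1n ?ltnS //.
- by rewrite leqW.
- by rewrite !leqW.
- by rewrite leqW.
Qed.

End Layers.

(* Haar measure on [K] would do for [c].  Instead, translates by a Folner set [s i]
   of the bump [height] are summed over a maximal [D]-separated family [T], which
   bounds the total mass from below, and its multiplicity from above. *)
Lemma local_reiter (K : set G) (eta : R) : nbhs 0 K -> 0 < eta ->
  exists V, nbhs 0 V /\ forall F : seq G, (forall h, h \in F -> V h) ->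
    exists c : fmeas R G, [/\ fm_prob c, forall i, K (fm_pt c i) &
      forall h, h \in F -> forall X : G -> R[i], (forall g, cmod (X g) <= 1) ->
        cmod (fm_C c (fun u => X (u + h)) - fm_C c X) <= eta].
Proof.
move=> nK eta0.
have [U] := G_lc (x := 0) I; rewrite withinET => nU [cU _].
have [D [nD D0 DN DK]] := nbhs0_symm (filterI nK nU).
have [D' [nD' _ D'N D'D]] := nbhs0_symm nD.
have [Z ZU] := compact_cover_translates cU nD'.
pose C := size Z.
(* The tent is so high that its variation, at most 1 at no more than [2 * C] places for each [i],
   costs only half of [eta] relative to the total mass. *)
pose n := (Num.truncn (4 * C%:R / eta)).+1.
have Cn : 2 * C%:R <= eta / 2 * n%:R.
  have : 4 * C%:R / eta <= n%:R by rewrite ltW // truncnS_gt.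
  rewrite ler_pdivrMr //; lra.
pose e : R := eta / 2 / C.+1%:R.
have e0 : 0 < e by rewrite !divr_gt0 ?ltr0n.
have eC : e * C%:R <= eta / 2.
  by rewrite /e mulrAC ler_pdivrMr ?ltr0n // ler_pM2l ?divr_gt0 // ler_nat.
have [V [nV V0 VN VD]] := nbhs0_nsum n nD.
exists V; split => // F FV.
have [I [s [I0 sP]]] := folner F e0.
have [T [uT Tc Ts]] := separated_cover (codom s) D0 DN.
pose f g := height D V n g.
pose J := seq_sub T.
pose KU := K `&` U.
have f_out g : ~ KU g -> f g = 0%N.
  move=> nKU; apply: big1 => j _; rewrite asboolF // => -[d [w [Dd wV gE]]].
  by apply: nKU; rewrite gE; apply: DK => //; apply: VD wV; apply: ltnW.
(* Packing: [U] is covered by [C] translates of [D'], and two indices that fall into the same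
   translate differ by an element of [D], so they coincide by separation. *)
have pack (g : G) : (#|[set j : J | `[< KU (ssval j + g)%R >] ]%SET| <= C)%N.
  have /choice[z zP] (j : J) : exists z, KU (ssval j + g) -> z \in Z /\ D' (ssval j + g - z).
    have [[_ /ZU[z zZ Dz]]|nKU] := pselect (KU (ssval j + g)); first by exists z.
    by exists 0.
  rewrite cardE -(size_map z); apply: uniq_leq_size.
    rewrite map_inj_in_uniq ?enum_uniq // => i j.
    rewrite !mem_enum !inE => Ki Kj zij.
    have [_ Di] := zP i Ki; have [_ Dj] := zP j Kj.
    apply: val_inj; apply: Ts; [exact: ssvalP|exact: ssvalP|].
    have -> : val i - val j = (val i + g - z i) + - (val j + g - z j).
      by rewrite zij opprB addrA subrK opprD addrA addrAC addrK.
    by apply: D'D => //; apply: D'N.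
  by move=> _ /mapP[j + ->]; rewrite mem_enum inE => Kj; have [] := zP j (asboolW Kj).
have f_shift g h : V h -> `|(f (g + h))%:R - (f g)%:R : R| <= 1.
  move=> Vh; have := @height_shift D V n g h Vh.
  have := @height_shift D V n (g + h) (- h) (VN _ Vh).
  rewrite addrK -/(f _) -/(f _) -!(ler_nat R) -!natr1 ler_norml => *.
  by apply/andP; split; lra.
pose g_ (i : I) (j : J) := ssval j + s i.
pose W : R := \sum_i \sum_j (f (g_ i j))%:R.
have W_ge : n%:R * #|I|%:R <= W.
  rewrite -mulrC mulr_natl -sumr_const ler_sum // => i _.
  have [t tT Dt] := Tc (s i) (codom_f s i).
  rewrite (bigD1 (SeqSub tT)) //= /f height_full // lerDl sumr_ge0 //.
have W0 : 0 < W by rewrite (lt_le_trans _ W_ge) // mulr_gt0 ?ltr0n.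
(* Points outside [K] carry weight 0 by [f_out]; they are moved to 0 so that the whole support lies
   in [K]. *)
pose c := @FMeas R G (I * J)%type (fun p => (f (g_ p.1 p.2))%:R / W)
  (fun p => if `[< K (g_ p.1 p.2) >] then g_ p.1 p.2 else 0).
have cE (Y : G -> R[i]) :
    fm_C c Y = W^-1%:C * \sum_i \sum_j (f (g_ i j))%:R * Y (g_ i j).
  rewrite /fm_C /= pair_big mulr_sumr; apply: eq_bigr => -[i j] _ /=.
  case: asboolP => [_|nKg]; last first.
    have -> : f (g_ i j) = 0%N by apply: f_out; case.
    by rewrite !mul0r mulr0.
  by rewrite rmorphM rmorph_nat /=; ring.
exists c; split.
- split=> [[i j]|] /=; first by rewrite divr_ge0 // ltW.
  by rewrite -mulr_suml -(pair_big xpredT xpredT (fun i j => (f (g_ i j))%:R)) divff ?gt_eqF.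
- by move=> [i j] /=; case: asboolP => // _; apply: nbhs_singleton nK.
move=> h hF X X1.
pose X' u := \sum_(j : J) (f (ssval j + u))%:R * X (ssval j + u) : R[i].
have cnt u : \sum_(j : J) (`[< KU (ssval j + u) >]%:R : R) <= C%:R.
  rewrite -natr_sum ler_nat (leq_trans _ (pack u)) // -sum1_card.
  rewrite [X in (_ <= X)%N]big_mkcond leq_sum //= => j _.
  by rewrite inE; case: asboolP.
have X'b u : cmod (X' u) <= n%:R * C%:R.
  rewrite (le_trans (cmod_sum _ _)) // (le_trans _ (ler_wpM2l _ (cnt u))) //.
  rewrite mulr_sumr ler_sum // => j _; rewrite cmodM cmod_nat.
  case: asboolP => [_|/f_out->]; rewrite ?mul0r ?mulr0 // mulr1.
  by rewrite -[n%:R]mulr1 ler_pM ?ler_nat ?cmod_ge0 ?height_le.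
rewrite !cE -mulrBr cmodM cmod_real ger0_norm ?invr_ge0 ?(ltW W0) //.
rewrite mulrC ler_pdivrMr //.
(* The shift by [h] splits into a Folner difference of the function [X'], summed over [s i], and a
   correction [r] for the variation of the weight [f]. *)
pose r (i : I) (j : J) := ((f (g_ i j + h))%:R - (f (g_ i j))%:R) * X (g_ i j + h).
rewrite -sumrB.
rewrite (eq_bigr (fun i => (X' (s i + h) - X' (s i)) - \sum_j r i j)); last first.
  move=> i _; rewrite /X' -!sumrB; apply: eq_bigr => j _.
  by rewrite /r /g_ !addrA; ring.
rewrite sumrB (le_trans (cmodB _ _)) //.
apply: le_trans (_ : e * (n%:R * C%:R) * #|I|%:R + 2 * C%:R * #|I|%:R <= _).
  apply: lerD; first exact: sP hF _ X' X'b.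
  rewrite mulr_natr -sumr_const (le_trans (cmod_sum _ _)) // ler_sum // => i _.
  rewrite (le_trans (cmod_sum _ _)) // mulr_natl mulr2n.
  apply: le_trans (lerD (cnt (s i)) (cnt (s i + h))).
  rewrite -big_split ler_sum //= => j _; rewrite /r cmodM /g_ addrA.
  have rE (a b : nat) : a%:R - b%:R = (a%:R - b%:R : R)%:C.
    by rewrite rmorphB !rmorph_nat.
  rewrite rE cmod_real.
  apply: le_trans (ler_piMr (normr_ge0 _) (X1 _)) _.
  case: (asboolP (KU (ssval j + s i))) => [_|nK1].
    by rewrite (le_trans (f_shift _ _ (FV _ hF))) // lerDl.
  case: (asboolP (KU (ssval j + s i + h))) => [_|nK2].
    by rewrite (le_trans (f_shift _ _ (FV _ hF))) // lerDr.
  by rewrite !f_out // subrr normr0 addr0.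
apply: le_trans (ler_wpM2l (ltW eta0) W_ge).
rewrite -mulrDl [eta * _]mulrA ler_wpM2r //.
by have := ler_wpM2l (ler0n R n) eC; lra.
Qed.

End Reiter.

(** * Finitely additive limits of finite measures *)

Section Ultra.
Variable R : realType.

Lemma ultra_lim (I : Type) (U : set_system I) (UU : UltraFilter U) (a : I -> R) (B : R) :
  U [set i | `|a i| <= B] ->
  exists l : R, forall e : R, 0 < e -> U [set i | `|a i - l| < e].
Proof.
move=> UB.
have FB : (a @ U) `[-B, B]%classic.
  by apply: (@filterS I U _ _ _ _ UB) => i /= iB; rewrite in_itv /= -ler_norml.
have [l [_ cl]] := @segment_compact R (-B) B (a @ U) _ FB.
exists l => e e0; set A := [set i | _].
have [//|nA] := in_ultra_setVsetC A UU.
have nball : (a @ U) (~` ball (l : R) e).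
  by apply: (@filterS I U _ _ _ _ nA) => i nAi ba; apply: nAi; rewrite /A /= distrC.
by have [x [nx bx]] := cl _ _ nball (nbhsx_ballx (l : R) e e0).
Qed.

(** A finitely additive measure on all subsets, with additivity split into two inequalities. The
    total mass is not normalised. *)
Record content (T : Type) (p : set T -> R) : Prop := Content {
  ct_ge0 : forall A, 0 <= p A;
  ct_0 : p set0 = 0;
  ct_le : forall A B, A `<=` B -> p A <= p B;
  ct_U : forall A B, p (A `|` B) <= p A + p B;
  ct_disj : forall A B, A `&` B = set0 -> p A + p B <= p (A `|` B) }.

(** [p] is the limit of the probabilities along an ultrafilter refining [F]. Non-strict inequalities
    valid for every [mu i] pass to the limit. *)
Lemma limit_content (T I : Type) (F : set_system I) (FF : ProperFilter F)
    (mu : I -> fmeas R T) : (forall i, fm_prob (mu i)) ->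
  exists p : set T -> R, [/\ content p,
    forall A c, F [set i | fm_P (mu i) A <= c] -> p A <= c &
    forall A c, F [set i | c <= fm_P (mu i) A] -> c <= p A].
Proof.
move=> mu1; have [U [UU FU]] := ultraFilterLemma FF.
have /choice[p pP] (A : set T) : exists l : R, forall e : R, 0 < e ->
    U [set i | `|fm_P (mu i) A - l| < e].
  apply: (@ultra_lim _ _ _ _ 1); apply: filterS filterT => i _ /=.
  by rewrite ger0_norm ?fm_P_le1 ?fm_P_ge0.
have p_le A c : U [set i | fm_P (mu i) A <= c] -> p A <= c.
  move=> Uc; apply/ler_addgt0Pr => e e0.
  have [i [/= ic]] := @filter_ex _ _ _ _ (filterI Uc (pP A e e0)).
  by rewrite ltr_norml => /andP[]; lra.
have p_ge A c : U [set i | c <= fm_P (mu i) A] -> c <= p A.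
  move=> Uc; apply/ler_addgt0Pr => e e0.
  have [i [/= ic]] := @filter_ex _ _ _ _ (filterI Uc (pP A e e0)).
  by rewrite ltr_norml => /andP[]; lra.
have p3 A B C : (U [set i | fm_P (mu i) A + fm_P (mu i) B <= fm_P (mu i) C] ->
      p A + p B <= p C) /\
   (U [set i | fm_P (mu i) C <= fm_P (mu i) A + fm_P (mu i) B] -> p C <= p A + p B).
  split=> UABC; apply/ler_addgt0Pr => e e0; (have e30 : 0 < e / 3 by rewrite divr_gt0);
  have [i [/= h [[]]]] := @filter_ex _ _ _ _ (filterI UABC (filterI
     (filterI (pP A _ e30) (pP B _ e30)) (pP C _ e30)));
  by rewrite /= !ltr_norml => /andP[? ?] /andP[? ?] /andP[? ?]; lra.
exists p; split=> [|A c|A c]; last 2 first.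
- by move/FU/p_le.
- by move/FU/p_ge.
split.
- by move=> A; apply: p_ge; apply: filterS filterT => i _; apply: fm_P_ge0.
- apply/eqP; rewrite eq_le; apply/andP; split; [apply: p_le|apply: p_ge];
    apply: filterS filterT => i _; last exact: fm_P_ge0.
  by rewrite /= /fm_P /fm_E big1 // => j _; rewrite asboolF // mulr0.
- move=> A B AB; rewrite -[p A]addr0.
  apply: le_trans (_ : p A + p set0 <= _).
    by rewrite lerD2l; apply: p_ge; apply: filterS filterT => i _; apply: fm_P_ge0.
  apply: (p3 _ _ _).1; apply: filterS filterT => i _ /=.
  by rewrite (le_trans (fm_P_disj _ _)) ?setI0 // setU0 fm_P_le.
- by move=> A B; apply: (p3 _ _ _).2; apply: filterS filterT => i _; apply: fm_PU.
- by move=> A B AB; apply: (p3 _ _ _).1; apply: filterS filterT => i _; apply: fm_P_disj.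
Qed.

Section ContentTheory.
Variables (T : Type) (p : set T -> R).
Hypothesis pC : content p.

Lemma content_big (n : nat) (A : nat -> set T) :
  p [set X | exists2 j, (j < n)%N & A j X] <= \sum_(j < n) p (A j).
Proof.
elim: n => [|n IHn].
  rewrite big_ord0 -(ct_0 pC); apply: (ct_le pC) => X [] //.
rewrite big_ord_recr /=; apply: le_trans (lerD IHn (lexx _)).
apply: le_trans (ct_U pC _ _); apply: (ct_le pC) => X [j].
rewrite ltnS leq_eqVlt => /orP[/eqP-> AX|jn AX]; [by right|left].
by exists j.
Qed.

Lemma content_null (J : eqType) (s : seq J) (A : J -> set T) :
  (forall j, j \in s -> p (A j) <= 0) ->
  p [set X | exists2 j, j \in s & A j X] <= 0.
Proof.
elim: s => [|a s IHs] As; first by rewrite -(ct_0 pC); apply: (ct_le pC) => X [].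
rewrite -[leRHS]addr0; apply: le_trans (lerD (As a (mem_head _ _)) (IHs _)); last first.
  by move=> j js; apply: As; rewrite in_cons js orbT.
apply: le_trans (ct_U pC _ _); apply: (ct_le pC) => X [j].
by rewrite in_cons => /orP[/eqP-> AX|js AX]; [left|right; exists j].
Qed.

(** For increasing [A] this stands in for continuity along the union: from an almost maximal [A m]
    on, at most [d] of mass is gained. *)
Lemma content_near_sup (A : nat -> set T) (d : R) : 0 < d ->
  exists m, forall n, p (A n) <= p (A m) + d.
Proof.
move=> d0; have hs : has_sup (range (fun n => p (A n))).
  split; first by exists (p (A 0%N)), 0%N.
  by exists (p setT) => _ [n _ <-]; apply: (ct_le pC).
have [_ [m _ <-] mlt] := sup_adherent d0 hs.
exists m => n; have : p (A n) <= sup (range (fun n => p (A n))).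
  by apply: sup_upper_bound => //; exists n.
lra.
Qed.

End ContentTheory.

Lemma geometric_le (c : R) n : 0 <= c -> \sum_(j < n) c / 2 ^+ j <= 2 * c.
Proof.
move=> c0; apply: le_trans (_ : 2 * c - 2 * c / 2 ^+ n <= _); last first.
  by rewrite lerBlDr lerDl divr_ge0 ?mulr_ge0 // exprn_ge0.
elim: n => [|n IHn]; first by rewrite big_ord0 expr0 divr1 subrr.
rewrite big_ord_recr /= (le_trans (lerD IHn (lexx _))) // exprS invfM.
by rewrite le_eqVlt; apply/orP; left; apply/eqP; field; rewrite expf_neq0.
Qed.

End Ultra.

(** * Extraction of a character from a content *)

Section CharacterOfContent.
Variables (R : realType) (G : topologicalZmodType).
Hypothesis G_lc : locally_compact [set: G].

(** Doubling in [G] squares the value of [chi], which moves values near 1 away from 1; so a crude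
    bound on [V] improves geometrically on smaller neighbourhoods, and multiplicativity carries
    continuity from 0 to every point. *)
Lemma character_of_bound (chi : G -> R[i]) (V : set G) : nbhs 0 V ->
  (forall x, cmod (chi x) = 1) -> (forall x y, chi (x + y) = chi x * chi y) ->
  (forall h, V h -> cmod (chi h - 1) <= 1 / 2) -> is_character chi.
Proof.
move=> nV chi1 chiD chiV.
have chi0 : chi 0 = 1.
  have := chiD 0 0; rewrite addr0 => c; apply: (mulfI (x := chi 0)); last by rewrite mulr1.
  by apply: contra_eq_neq (chi1 0) => ->; rewrite cmod0 eq_sym oner_neq0.
(* If [`|z| = 1] and [`|z - 1| <= 1/2] then [`|z ^+ 2 - 1| >= 3/2 * `|z - 1|]. *)
have half k : exists2 V', nbhs 0 V' &
    forall h, V' h -> cmod (chi h - 1) <= 1 / 2 * (2 / 3) ^+ k.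
  elim: k => [|k [V' nV' hV']]; first by exists V => // h; rewrite expr0 mulr1; apply: chiV.
  have [V2 [nV2 V20 _ V2V]] := nbhs0_symm (filterI nV' nV).
  exists V2 => // h V2h.
  have [_ /chiV h1] := V2V h 0 V2h V20; rewrite addr0 in h1.
  have [/hV' h2 _] := V2V h h V2h V2h.
  have dbl : chi (h + h) - 1 = (chi h - 1) * (chi h + 1) by rewrite chiD; ring.
  rewrite dbl cmodM in h2.
  have h3 : 3 / 2 <= cmod (chi h + 1).
    have -> : chi h + 1 = 2 + (chi h - 1) by ring.
    have := cmodB (2 + (chi h - 1)) (chi h - 1); rewrite addrK (cmod_nat R 2); lra.
  have h4 := ler_wpM2l (cmod_ge0 (chi h - 1)) h3.
  rewrite exprS; set t := (2 / 3) ^+ k in h2 *; lra.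
split; first by move=> x; rewrite normC_cmod chi1.
split=> // x0 e e0.
have [k ke] : exists k, (2 / 3 : R) ^+ k < e.
  have /cvgrPdist_lt /(_ e e0) [k _ kP] : ((2 / 3 : R) ^+ n) @[n --> \oo] --> (0 : R).
    by apply: cvg_expr; rewrite ger0_norm; lra.
  exists k; have := kP k (leqnn k); rewrite /= sub0r normrN ger0_norm ?exprn_ge0 //; lra.
have [V' nV' hV'] := half k.
apply: filterS (nbhs_shift x0 nV') => x /hV' xk.
have -> : chi x - chi x0 = chi x0 * (chi (x - x0) - 1).
  by rewrite mulrBr mulr1 -chiD (addrC x0) subrK.
rewrite normC_cmod ltcR cmodM chi1 mul1r (le_lt_trans xk) //.
have : 0 <= (2 / 3 : R) ^+ k by rewrite exprn_ge0.
lra.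
Qed.

Definition cesaro (g : nat -> G) N (X : G -> R[i]) : R[i] :=
  N%:R^-1 * \sum_(k < N) X (g k).

Lemma cesaro_dist g N (X Y : G -> R[i]) (d : R) :
  (forall k, (k < N)%N -> cmod (X (g k) - Y (g k)) <= d) -> 0 <= d ->
  cmod (cesaro g N X - cesaro g N Y) <= d.
Proof.
move=> XY d0; rewrite /cesaro -mulrBr cmodM cmodV cmod_nat -sumrB.
case: N XY => [|N] XY; first by rewrite invr0 mul0r.
rewrite mulrC ler_pdivrMr ?ltr0n // (le_trans (cmod_sum _ _)) //.
rewrite mulr_natr -[X in _ *+ X]card_ord -sumr_const ler_sum // => k _; exact: XY.
Qed.

Section Content.
Variables (p : set (G -> R[i]) -> R) (theta eta : R).
Variables (e : nat -> G -> R[i]) (g : nat -> G).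
Hypotheses (pC : content p) (theta0 : 0 < theta) (eta0 : 0 < eta).
Hypothesis p_circle : p [set X | exists x, cmod (X x) != 1] <= 0.
Hypothesis p_morph : forall a b r, 0 < r ->
  p [set X | r <= cmod (X (a + b) - X a * X b)] <= 0.
Hypothesis p_near1 : exists2 K, nbhs 0 K & forall c : fmeas R G, fm_prob c ->
  (forall i, K (fm_pt c i)) -> p [set X | 1 / 2 <= cmod (fm_C c X - 1)] <= theta / 8.
Hypothesis p_avoid : forall j, is_character (e j) -> exists (H : seq G) (r : R), 0 < r /\
  p [set X | forall h, h \in H -> cmod (X h - e j h) < r] <= theta / 16 / 2 ^+ j.
Hypothesis p_cesaro : forall n, exists2 N, (n <= N)%N &
  theta <= p [set X | eta <= cmod (cesaro g N X)].

(** For multiplicative [X], the average [Z] of [X] under [c] satisfies: [Z * (X h - 1)] is almost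
    the change of that average under translation by [h], hence at most 1/8. Outside an event of mass
    [theta / 8] the modulus of [Z] exceeds 1/2, which forces [X h] within 1/4 of 1. The measure [c]
    depends on [F], but [V] does not. *)
Lemma p_equicontinuous : exists2 V, nbhs 0 V & forall F : seq G,
  (forall h, h \in F -> V h) ->
  p [set X | exists2 h, h \in F & 1 / 4 < cmod (X h - 1)] <= theta / 8.
Proof.
have [K nK pK] := p_near1.
have e16 : (0 : R) < 1 / 16 by lra.
have [V [nV VP]] := local_reiter G_lc nK e16.
exists V => // F FV; have [c [c1 cK cF]] := VP F FV.
pose Bad := [set X : G -> R[i] | exists x, cmod (X x) != 1] `|`
  [set X | exists2 hi : G * fm_idx c, hi \in [seq (h, i) | h <- F, i <- enum (fm_idx c)] &
     1 / 16 <= cmod (X (fm_pt c hi.2 + hi.1) - X (fm_pt c hi.2) * X hi.1)].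
have pBad : p Bad <= 0.
  rewrite -[leRHS]addr0 (le_trans (ct_U pC _ _)) // lerD //.
  by apply: (content_null pC) => hi _; apply: p_morph; lra.
rewrite -[leRHS]add0r; apply: le_trans (lerD pBad (pK c c1 cK)).
apply: le_trans (ct_U pC _ _); apply: (ct_le pC) => X [h hF Xh].
have [|nB] := pselect (Bad X); [by left|right].
rewrite /= leNgt; apply/negP => Z1.
have X1 x : cmod (X x) = 1.
  by apply/eqP/negPn/negP => nx; apply: nB; left; exists x.
have X1' x : cmod (X x) <= 1 by rewrite X1.
have h1 := cF h hF X X1'.
set Z := fm_C c X in h1 Z1.
have h2 : cmod (fm_C c (fun u => X (u + h)) - Z * X h) <= 1 / 16.
  have -> : Z * X h = fm_C c (fun u => X u * X h).
    by rewrite /Z /fm_C mulr_suml; apply: eq_bigr => i _; rewrite mulrA.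
  rewrite fm_CB (le_trans (fm_C_cmod _ c1)) // -[leRHS](fm_E_cst (1 / 16) c1).
  apply: fm_E_le => // i; rewrite leNgt; apply/negP => lt16; apply: nB; right.
  by exists (h, i); [rewrite allpairs_f ?mem_enum|rewrite /= ltW].
have Z2 : 1 / 2 < cmod Z.
  by have := cmodB Z (Z - 1); rewrite subKr cmod1; lra.
have Z3 : cmod (Z * (X h - 1)) <= 1 / 8.
  have -> : Z * (X h - 1) = - ((fm_C c (fun u => X (u + h)) - Z * X h) -
     (fm_C c (fun u => X (u + h)) - Z)) by ring.
  by rewrite cmodN (le_trans (cmodB _ _)) // (le_trans (lerD h2 h1)) //; lra.
move: Z3; rewrite cmodM leNgt => /negP; apply.
have := ltr_pM (_ : 0 <= 1 / 2) (_ : 0 <= 1 / 4) Z2 Xh; lra.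
Qed.

(** The unwanted events use up less than [theta], so finitely many requirements can be met together,
    even off a null set. They generate a filter; [chi] is a pointwise limit along an ultrafilter
    refining it. Equicontinuity makes [chi] continuous, and the remaining requirements involve
    finitely many points each, so they survive the limit. *)
Lemma character_of_content : exists chi : G -> R[i],
  [/\ is_character chi, forall j, chi <> e j & ~ cesaro_to_0 g chi].
Proof.
have [V nV pV] := p_equicontinuous.
(* A content need not be continuous along decreasing sequences: the limsup event is
   replaced by finite windows [win j (m j)], each of which loses little mass. *)
pose win j n : set (G -> R[i]) :=
  [set X | exists2 N, (j <= N <= n)%N & eta <= cmod (cesaro g N X)].
have d0 j : 0 < theta / 16 / 2 ^+ j by rewrite !divr_gt0 // exprn_gt0.
have /choice[m mP] j : exists m, forall n, p (win j n) <= p (win j m) + theta / 16 / 2 ^+ j.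
  exact: content_near_sup.
(* [bad j] is the event of being close to [e j]; it is taken empty when [e j] is not a character. *)
have /choice[bad badP] j : exists A : set (G -> R[i]), p A <= theta / 16 / 2 ^+ j /\
    (is_character (e j) -> exists (H : seq G) (r : R), 0 < r /\
      A = [set X | forall h, h \in H -> cmod (X h - e j h) < r]).
  have [ec|nec] := pselect (is_character (e j)).
    have [H [r [r0 pH]]] := p_avoid ec; exists [set X | forall h, h \in H -> cmod (X h - e j h) < r].
    by split => // _; exists H, r.
  by exists set0; split => //; rewrite (ct_0 pC) ltW.
pose good J (F : seq G) : set (G -> R[i]) := [set X |
  (forall j, (j <= J)%N -> win j (m j) X /\ ~ bad j X) /\
  (forall h, h \in F -> cmod (X h - 1) <= 1 / 4)].
have good_ex J F B : (forall h, h \in F -> V h) -> p B <= 0 ->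
    exists X, good J F X /\ ~ B X.
  move=> FV pB; apply: contrapT => nX.
  have [N JN pN] := p_cesaro J.
  pose A j := (win J N `\` win j (m j)) `|` bad j.
  have pA j : (j <= J)%N -> p (A j) <= theta / 8 / 2 ^+ j.
    move=> jJ; rewrite (le_trans (ct_U pC _ _)) //.
    have := (badP j).1; set a := win J N `\` _.
    suff : p a <= theta / 16 / 2 ^+ j.
      have -> : theta / 8 / 2 ^+ j = 2 * (theta / 16 / 2 ^+ j).
        by field; rewrite expf_neq0.
      lra.
    (* [win j (m j)] is almost as heavy as the larger [win j M], so the part [a] of it that is
       disjoint from [win j (m j)] has little mass. *)
    pose M := maxn N (m j).
    have aM : a `|` win j (m j) `<=` win j M.
      move=> X [[[k /andP[Jk kN] Xk] _]|[k /andP[jk km] Xk]]; exists k => //.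
        by rewrite (leq_trans jJ Jk) (leq_trans kN) // leq_maxl.
      by rewrite jk (leq_trans km) // leq_maxr.
    have := ct_le pC aM; have := mP j M.
    have : p a + p (win j (m j)) <= p (a `|` win j (m j)).
      by apply: (ct_disj pC); rewrite /a setDKI.
    lra.
  pose E := [set X : G -> R[i] | exists2 h, h \in F & 1 / 4 < cmod (X h - 1)].
  have cov : [set X | eta <= cmod (cesaro g N X)] `<=`
      ([set X | exists2 j, (j < J.+1)%N & A j X] `|` E) `|` B.
    move=> X XN; apply: contrapT => nAEB; apply: nX; exists X; split; last first.
      by move=> BX; apply: nAEB; right.
    split=> [j jJ|h hF]; last first.
      by rewrite leNgt; apply/negP => hh; apply: nAEB; left; right; exists h.
    have nA : ~ A j X by move=> AX; apply: nAEB; left; left; exists j.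
    split; last by move=> bX; apply: nA; right.
    apply: contrapT => nw; apply: nA; left; split => //.
    by exists N => //; rewrite JN /=.
  (* Mass count: the failures [A j] sum to at most [2 * (theta / 8)] and failure of equicontinuity
     costs [theta / 8], together less than [theta]. *)
  suff : theta <= 2 * (theta / 8) + theta / 8 by move: theta0; lra.
  rewrite (le_trans pN) // (le_trans (ct_le pC cov)) // (le_trans (ct_U pC _ _)) //.
  rewrite -[leRHS]addr0 lerD // (le_trans (ct_U pC _ _)) // lerD ?pV //.
  have t8 : 0 <= theta / 8 by rewrite divr_ge0 // ltW.
  rewrite (le_trans (content_big pC J.+1 A)) // (le_trans _ (geometric_le J.+1 t8)) //.
  by apply: ler_sum => j _; apply: pA; rewrite -ltnS.
pose Fl : set_system (G -> R[i]) := [set A | exists J F B,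
  [/\ forall h, h \in F -> V h, p B <= 0 & good J F `\` B `<=` A]].
have FlP : ProperFilter Fl.
  apply: Build_ProperFilter_ex.
    move=> A [J [F [B [FV pB sA]]]]; have [X [gX nB]] := good_ex J F B FV pB.
    by exists X; apply: sA.
  split.
  - by exists 0%N, [::], set0; split => //; rewrite (ct_0 pC).
  - move=> A A' [J [F [B [FV pB sA]]]] [J' [F' [B' [FV' pB' sA']]]].
    exists (maxn J J'), (F ++ F'), (B `|` B'); split.
    + by move=> h; rewrite mem_cat => /orP[/FV|/FV'].
    + by rewrite (le_trans (ct_U pC _ _)) // -[leRHS]addr0 lerD.
    move=> X [[gX gF] nB]; split; [apply: sA|apply: sA']; split.
    + split=> [j jJ|h hF]; first by apply: gX; rewrite (leq_trans jJ) // leq_maxl.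
      by apply: gF; rewrite mem_cat hF.
    + by move=> BX; apply: nB; left.
    + split=> [j jJ|h hF]; first by apply: gX; rewrite (leq_trans jJ) // leq_maxr.
      by apply: gF; rewrite mem_cat hF orbT.
    + by move=> BX; apply: nB; right.
  - by move=> A A' AA' [J [F [B [FV pB sA]]]]; exists J, F, B; split => // X /sA/AA'.
have [U [UU FlU]] := ultraFilterLemma FlP.
have Unull B : p B <= 0 -> U (~` B).
  by move=> pB; apply: FlU; exists 0%N, [::], B; split => // X [].
have Ucirc : U [set X | forall x, cmod (X x) = 1].
  apply: filterS (Unull _ p_circle) => X nX x.
  by apply/eqP/negPn/negP => nx; apply: nX; exists x.
have /choice[chi chiP] x : exists z : R[i], forall d : R, 0 < d ->
    U [set X | cmod (X x - z) < d].
  have bnd (f : R[i] -> R) : (forall z, `|f z| <= cmod z) ->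
      exists l : R, forall d : R, 0 < d -> U [set X : G -> R[i] | `|f (X x) - l| < d].
    move=> fz; apply: (@ultra_lim _ _ _ _ _ 1).
    by apply: filterS Ucirc => X X1; rewrite /= (le_trans (fz _)) // X1.
  have [u uP] := bnd (@complex.Re R) (@cmodRe R).
  have [v vP] := bnd (@complex.Im R) (@cmodIm R).
  exists (u +i* v) => d dp; have d20 : 0 < d / 2 by rewrite divr_gt0.
  apply: filterS (filterI (uP _ d20) (vP _ d20)) => X [/= Xu Xv].
  apply: (le_lt_trans (cmod_ReIm _)).
  have -> : complex.Re (X x - (u +i* v)) = complex.Re (X x) - u by case: (X x).
  have -> : complex.Im (X x - (u +i* v)) = complex.Im (X x) - v by case: (X x).
  lra.
have Useq (s : seq G) (d : R) : 0 < d ->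
    U [set X | forall x, x \in s -> cmod (X x - chi x) < d].
  move=> d1; elim: s => [|a s IHs]; first exact: filterS filterT.
  apply: filterS (filterI (chiP a d d1) IHs) => X [/= Xa Xs] x.
  by rewrite in_cons => /orP[/eqP->|/Xs].
have chi1 x : cmod (chi x) = 1.
  have h d : 0 < d -> `|cmod (chi x) - 1| <= d.
    move=> d1; have [X [/= X1 Xx]] := @filter_ex _ _ _ _ (filterI Ucirc (chiP x d d1)).
    have := cmodB (X x) (X x - chi x); rewrite subKr X1.
    have := cmodD (X x - chi x) (chi x); rewrite subrK X1.
    by rewrite ler_norml; lra.
  have /eqP : `|cmod (chi x) - 1| = 0.
    apply/eqP; rewrite eq_le normr_ge0 andbT; apply/ler_addgt0Pr => d d1.
    by rewrite add0r h.
  by rewrite normr_eq0 subr_eq0 => /eqP.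
have chiD a b : chi (a + b) = chi a * chi b.
  apply/eqP; rewrite -subr_eq0; apply/eqP/cmod_eq0/eqP.
  rewrite eq_le cmod_ge0 andbT; apply/ler_addgt0Pr => d d1; rewrite add0r.
  have d40 : 0 < d / 4 by rewrite divr_gt0.
  have [X [[/= X1 Xs] /negP]] := @filter_ex _ _ _ _ (filterI (filterI Ucirc
    (Useq [:: a; b; a + b] _ d40)) (Unull _ (p_morph a b d40))).
  rewrite -ltNge => Xab.
  have Xa := Xs a (mem_head _ _); have Xb := Xs b _; have Xc := Xs (a + b) _.
  have -> : chi (a + b) - chi a * chi b = - (X (a + b) - chi (a + b)) +
     (X (a + b) - X a * X b) + ((X a - chi a) * X b + chi a * (X b - chi b)) by ring.
  rewrite (le_trans (cmodD _ _)) //.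
  have := cmodD (- (X (a + b) - chi (a + b))) (X (a + b) - X a * X b).
  have := cmodD ((X a - chi a) * X b) (chi a * (X b - chi b)).
  rewrite !cmodM cmodN chi1 X1 mulr1 mul1r.
  by have := Xb _; have := Xc _; rewrite !inE !eqxx !orbT => /(_ isT) ? /(_ isT) ?; lra.
have chi_char : is_character chi.
  apply: (character_of_bound nV) => // h Vh.
  have Ugood : U [set X | cmod (X h - 1) <= 1 / 4].
    apply: FlU; exists 0%N, [:: h], set0; split; last first.
    - by move=> X [[_ gX] _]; apply: gX; rewrite mem_head.
    - by rewrite (ct_0 pC).
    - by move=> x; rewrite inE => /eqP->.
  have q0 : (0 : R) < 1 / 4 by lra.
  have [X [/= X1 Xh]] := @filter_ex _ _ _ _ (filterI Ugood (chiP h _ q0)).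
  by have := cmod_tri (chi h) (X h) 1; rewrite [cmod (chi h - X h)]cmodC; lra.
have Uwin j : U (win j (m j) `&` ~` bad j).
  apply: FlU; exists j, [::], set0; split => //; first by rewrite (ct_0 pC).
  by move=> X [[gX _] _]; apply: gX.
exists chi; split => //.
- move=> j chij; have [H [r [r0 badE]]] := (badP j).2 (eq_ind _ _ chi_char _ chij).
  have [X [[_ nb] Xs]] := @filter_ex _ _ _ _ (filterI (Uwin j) (Useq H r r0)).
  by apply: nb; rewrite badE -chij.
- move=> /(_ (eta / 2)) []; first by rewrite divr_gt0.
  move=> N0 N0P; have e20 : 0 < eta / 2 by rewrite divr_gt0.
  (* All means in the window starting at [N0] depend only on the [g k] with [k < m N0], so closeness
     of [X] to [chi] at these points suffices. *)
  have [X [[[N /andP[N0N Nm] XN] _] /= Xs]] := @filter_ex _ _ _ _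
    (filterI (Uwin N0) (Useq [seq g k | k <- iota 0 (m N0)] _ e20)).
  have := N0P N N0N; rewrite normC_cmod ltcR -/(cesaro g N chi).
  have : cmod (cesaro g N X - cesaro g N chi) <= eta / 2.
    apply: cesaro_dist; last exact: ltW.
    move=> k kN; rewrite ltW // Xs // map_f // mem_iota /= add0n.
    exact: leq_trans kN Nm.
  by have := cmodD (cesaro g N X - cesaro g N chi) (cesaro g N chi); rewrite subrK; lra.
Qed.

End Content.
End CharacterOfContent.

(** * Spectral resolutions *)

Lemma prim_root_exists (F : numClosedFieldType) n : (0 < n)%N ->
  exists z : F, n.-primitive_root z.
Proof.
move=> n0; pose p : {poly F} := 'X^n - 1; have [r pE] := closed_field_poly_normal p.
have {}pE : p = \prod_(z <- r) ('X - z%:P).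
  by rewrite pE (monicP _) ?monicXnsubC // scale1r.
have sr : size r = n.
  by apply/eqP; rewrite -eqSS -(size_prod_XsubC r id) -pE size_XnsubC.
have ur : uniq r.
  by rewrite -separable_prod_XsubC -pE separable_Xn_sub_1 // pnatr_eq0 -lt0n.
have /hasP[z _ zP] : has n.-primitive_root r.
  apply: has_prim_root => //; last by rewrite sr.
  by apply/allP => z; rewrite -root_prod_XsubC -pE.
by exists z.
Qed.

(** * Inner products and the discrete Fourier transform *)

Section InnerProduct.
Variables (R : realType) (V : lmodType R[i]) (ip : V -> V -> R[i]).
Hypothesis ipP : is_inner_product ip.
Local Notation nrm := (ipnorm ip).
Implicit Types x y z : V.

Definition sqnorm x : R := complex.Re (ip x x).
Local Notation n2 := sqnorm.

Lemma ipDl x y z : ip (x + y) z = ip x z + ip y z.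
Proof. exact: ipP.1. Qed.

Lemma ipZl a x y : ip (a *: x) y = a * ip x y.
Proof. exact: ipP.2.1. Qed.

Lemma ipC x y : ip y x = (ip x y)^*%C.
Proof. exact: ipP.2.2.1. Qed.

Lemma ipE x : ip x x = (n2 x)%:C.
Proof.
have := ipP.2.2.2.1 x; rewrite /sqnorm => /ger0_Im im0.
by rewrite [LHS]complexE im0 rmorph0 mulr0 addr0.
Qed.

Lemma n2_ge0 x : 0 <= n2 x.
Proof. by have := ipP.2.2.2.1 x; rewrite ipE ler0c. Qed.

Lemma n2_eq0 x : n2 x = 0 -> x = 0.
Proof. by move=> x0; apply: ipP.2.2.2.2; rewrite ipE x0. Qed.

Lemma ip0l x : ip 0 x = 0.
Proof. by rewrite -(scale0r 0) ipZl mul0r. Qed.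

Lemma ipDr x y z : ip z (x + y) = ip z x + ip z y.
Proof. by rewrite ipC ipDl rmorphD /= -!ipC. Qed.

Lemma ipZr a x y : ip y (a *: x) = a^*%C * ip y x.
Proof. by rewrite ipC ipZl rmorphM /= -ipC. Qed.

Lemma ip0r x : ip x 0 = 0.
Proof. by rewrite ipC ip0l conjc0. Qed.

Lemma ipNl x y : ip (- x) y = - ip x y.
Proof. by rewrite -scaleN1r ipZl mulN1r. Qed.

Lemma ipNr x y : ip x (- y) = - ip x y.
Proof. by rewrite ipC ipNl rmorphN /= -ipC. Qed.

Lemma ipBl x y z : ip (x - y) z = ip x z - ip y z.
Proof. by rewrite ipDl ipNl. Qed.

Lemma ip_suml (I : finType) (P : pred I) (f : I -> V) y :
  ip (\sum_(i | P i) f i) y = \sum_(i | P i) ip (f i) y.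
Proof. by elim/big_rec2: _ => [|i a b _ <-]; rewrite ?ip0l ?ipDl. Qed.

Lemma ip_sumr (I : finType) (P : pred I) (f : I -> V) y :
  ip y (\sum_(i | P i) f i) = \sum_(i | P i) ip y (f i).
Proof. by elim/big_rec2: _ => [|i a b _ <-]; rewrite ?ip0r ?ipDr. Qed.

Lemma nrm_ge0 x : 0 <= nrm x.
Proof. exact: sqrtr_ge0. Qed.

Lemma nrm_sqr x : nrm x ^+ 2 = n2 x.
Proof. by rewrite sqr_sqrtr // n2_ge0. Qed.

Lemma nrm0 : nrm 0 = 0.
Proof. by rewrite /ipnorm ip0l sqrtr0. Qed.

Lemma n2Z a x : n2 (a *: x) = cmod a ^+ 2 * n2 x.
Proof.
apply: complexI; rewrite -ipE ipZl ipZr mulrA -sqr_cmod ipE.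
by rewrite [RHS]rmorphM.
Qed.

Lemma nrmZ a x : nrm (a *: x) = cmod a * nrm x.
Proof.
apply/eqP; rewrite -(@eqrXn2 _ 2) ?nrm_ge0 //; last first.
  by rewrite mulr_ge0 ?cmod_ge0 ?nrm_ge0.
by rewrite exprMn !nrm_sqr n2Z.
Qed.

Lemma nrmN x : nrm (- x) = nrm x.
Proof. by rewrite -scaleN1r nrmZ cmodN cmod1 mul1r. Qed.

Lemma n2D x y : n2 (x + y) = n2 x + n2 y + 2 * complex.Re (ip x y).
Proof.
rewrite /sqnorm ipDl !ipDr [ip y x]ipC.
by case: (ip x x) (ip y y) (ip x y) => [a b] [c d] [u v] /=; ring.
Qed.

Lemma n2N x : n2 (- x) = n2 x.
Proof. by rewrite /sqnorm ipNl ipNr opprK. Qed.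

Lemma n2_parallelogram x y : n2 (x + y) + n2 (x - y) = 2 * n2 x + 2 * n2 y.
Proof.
rewrite !n2D n2N ipNr; case: (ip x y) => a b /=; ring.
Qed.

Lemma n2_le2 x y : n2 (x + y) <= 2 * n2 x + 2 * n2 y.
Proof. by have := n2_parallelogram x y; have := n2_ge0 (x - y); lra. Qed.

Lemma cauchy_schwarz x y : cmod (ip x y) <= nrm x * nrm y.
Proof.
rewrite -(@ler_pXn2r _ 2) ?nnegrE ?cmod_ge0 //; last first.
  by rewrite mulr_ge0 ?nrm_ge0.
rewrite exprMn !nrm_sqr.
have [y0|y_neq0] := eqVneq (n2 y) 0.
  by rewrite (n2_eq0 y0) ip0r cmod0 expr0n /= mulr_ge0 ?n2_ge0.
have y_gt0 : 0 < n2 y by rewrite lt_def y_neq0 n2_ge0.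
have : 0 <= n2 ((n2 y)%:C *: x - ip x y *: y) by apply: n2_ge0.
suff -> : n2 ((n2 y)%:C *: x - ip x y *: y) =
    n2 y * (n2 x * n2 y - cmod (ip x y) ^+ 2) by rewrite pmulr_rge0 // subr_ge0.
apply: complexI; rewrite -(ipE (_ - _)) ipBl !ipDr !ipNr !ipZl !ipZr !ipE [ip y x]ipC !conjc_real.
transitivity ((n2 y)%:C * ((n2 x)%:C * (n2 y)%:C - ip x y * (ip x y)^*%C)); first by ring.
by rewrite -sqr_cmod -!(rmorphM, rmorphB).
Qed.

Lemma nrmD x y : nrm (x + y) <= nrm x + nrm y.
Proof.
rewrite -(@ler_pXn2r _ 2) ?nnegrE ?addr_ge0 ?nrm_ge0 //.
rewrite sqrrD !nrm_sqr n2D.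
have := cauchy_schwarz x y; have := cmodRe (ip x y).
by rewrite ler_norml => /andP[_]; lra.
Qed.

Lemma nrmC x y : nrm (x - y) = nrm (y - x).
Proof. by rewrite -nrmN opprB. Qed.

Lemma nrm_tri y x z : nrm (x - z) <= nrm (x - y) + nrm (y - z).
Proof.
have -> : x - z = (x - y) + (y - z) by rewrite addrA subrK.
exact: nrmD.
Qed.

Lemma nrm_sum (I : finType) (f : I -> V) : nrm (\sum_i f i) <= \sum_i nrm (f i).
Proof.
elim/big_rec2: _ => [|i a b _ le_ba]; first by rewrite nrm0.
by rewrite (le_trans (nrmD _ _)) // lerD2l.
Qed.

Lemma nrm_eq0 x : nrm x = 0 -> x = 0.
Proof. by move=> x0; apply: n2_eq0; rewrite -nrm_sqr x0 expr0n. Qed.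

Lemma sqr_sum_le (I : finType) (b : I -> R) :
  (\sum_i b i) ^+ 2 <= #|I|%:R * \sum_i b i ^+ 2.
Proof.
have [I0|I_gt0] := posnP #|I|.
  by rewrite !big_pred0 ?expr0n ?mulr0 // => i; have := fintype0 i I0.
have n0 : (#|I|%:R : R) != 0 by rewrite pnatr_eq0 -lt0n.
pose m := @FMeas R I I (fun=> #|I|%:R^-1) id.
have mp : fm_prob m.
  split=> [i /=|/=]; first by rewrite invr_ge0.
  by rewrite sumr_const -[_^-1 *+ _]mulr_natl divff.
have := fm_E_sqr b mp; rewrite /fm_E /= -!mulr_sumr exprMn => h.
have := ler_wpM2l (sqr_ge0 (#|I|%:R : R)) h.
by rewrite mulrA -exprMn divff // expr1n mul1r expr2 -mulrA [_ * (_^-1 * _)]mulrA divff // mul1r.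
Qed.

Lemma n2_sumZ (I : finType) (a : I -> R[i]) (v : I -> V) :
  n2 (\sum_i a i *: v i) <= #|I|%:R * \sum_i cmod (a i) ^+ 2 * n2 (v i).
Proof.
rewrite -nrm_sqr; apply: le_trans (_ : (\sum_i cmod (a i) * nrm (v i)) ^+ 2 <= _).
  have le_s : nrm (\sum_i a i *: v i) <= \sum_i cmod (a i) * nrm (v i).
    by rewrite (le_trans (nrm_sum _)) // ler_sum // => i _; rewrite nrmZ.
  by rewrite ler_pXn2r // nnegrE ?nrm_ge0 // (le_trans _ le_s) ?nrm_ge0.
apply: le_trans (sqr_sum_le _) _; rewrite ler_wpM2l // ler_sum // => i _.
by rewrite exprMn nrm_sqr.
Qed.

(** Parseval's identity on the cyclic group of order [N] for vector-valued functions: after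
    expanding the squares, the off-diagonal terms contain full geometric sums of nontrivial roots of
    unity. *)
Lemma n2_dft (N : nat) (w : R[i]) (u : 'I_N -> V) :
  N.-primitive_root w -> cmod w = 1 ->
  \sum_(k < N) n2 (\sum_(n < N) w ^+ (k * n) *: u n) = N%:R * \sum_(n < N) n2 (u n).
Proof.
move=> wN w1; apply: complexI; rewrite rmorph_sum rmorphM rmorph_nat rmorph_sum /=.
have w_neq0 : w != 0 by apply: contra_eq_neq w1 => ->; rewrite cmod0 eq_sym oner_neq0.
have wX n : cmod (w ^+ n) = 1 by rewrite cmodX w1 expr1n.
have termE (k : 'I_N) : (n2 (\sum_(n < N) w ^+ (k * n) *: u n))%:C =
    \sum_(n < N) \sum_(m < N) (w ^+ n / w ^+ m) ^+ k * ip (u n) (u m).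
  rewrite -ipE ip_suml; apply: eq_bigr => n _; rewrite ip_sumr; apply: eq_bigr => m _.
  rewrite ipZl ipZr mulrA conj_inv // exprMn exprVn -!exprM.
  by rewrite [(n * k)%N]mulnC [(m * k)%N]mulnC.
rewrite (eq_bigr _ (fun k _ => termE k)) exchange_big mulr_sumr.
apply: eq_bigr => n _ /=.
rewrite exchange_big (bigD1 n) //= [X in _ + X]big1 ?addr0 => [|m mn].
  rewrite (eq_bigr (fun=> (n2 (u n))%:C)) ?sumr_const ?card_ord ?mulr_natl // => k _.
  by rewrite ipE divff ?expr1n ?mul1r // expf_neq0.
rewrite -mulr_suml; set z := w ^+ n / w ^+ m.
have z1 : z - 1 != 0.
  rewrite subr_eq0; apply: contra mn => /eqP z1; apply/eqP/val_inj/esym/eqP => /=.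
  have : w ^+ n = w ^+ m by rewrite -[RHS]mul1r -z1 mulfVK // expf_neq0.
  by move/eqP; rewrite (eq_prim_root_expr wN) !modn_small.
have : (z - 1) * \sum_(k < N) z ^+ k = 0.
  rewrite -subrX1 /z exprMn exprVn -!exprM ![(_ * N)%N]mulnC !exprM (prim_expr_order wN).
  by rewrite !expr1n divr1 subrr.
by move/eqP; rewrite mulf_eq0 (negPf z1) => /eqP->; rewrite mul0r.
Qed.

End InnerProduct.

(** * Approximate joint eigenvectors of a unitary representation *)

Section Representation.
Variables (R : realType) (G : topologicalZmodType).
Variables (V : lmodType R[i]) (ip : V -> V -> R[i]) (pi : G -> V -> V).
Hypothesis ipP : is_inner_product ip.
Hypothesis piP : is_unitary_rep ip pi.
Local Notation nrm := (ipnorm ip).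
Local Notation n2 := (sqnorm ip).

Lemma pi_lin g a x y : pi g (a *: x + y) = a *: pi g x + pi g y.
Proof. exact: piP.1. Qed.

Lemma pi_ip g x y : ip (pi g x) (pi g y) = ip x y.
Proof. exact: piP.2.1. Qed.

Lemma pi0 x : pi 0 x = x.
Proof. exact: piP.2.2.2.1. Qed.

Lemma piM g h x : pi (g + h) x = pi g (pi h x).
Proof. exact: piP.2.2.2.2.1. Qed.

Lemma pi_cont x g e : 0 < e -> \forall h \near g, nrm (pi h x - pi g x) < e.
Proof. exact: piP.2.2.2.2.2. Qed.

Section LinearMap.
Variable L : V -> V.
Hypothesis L_lin : forall a x y, L (a *: x + y) = a *: L x + L y.

Lemma lin0 : L 0 = 0.
Proof.
have := L_lin 1 0 0; rewrite !scale1r addr0 => h.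
by apply: (addIr (L 0)); rewrite add0r -h.
Qed.

Lemma linZ a x : L (a *: x) = a *: L x.
Proof. by rewrite -[_ *: _ in LHS]addr0 L_lin lin0 addr0. Qed.

Lemma linB x y : L (x - y) = L x - L y.
Proof. by rewrite addrC -scaleN1r L_lin scaleN1r addrC. Qed.

Lemma lin_sumZ (I : finType) (a : I -> R[i]) (v : I -> V) :
  L (\sum_i a i *: v i) = \sum_i a i *: L (v i).
Proof.
by elim/big_rec2: _ => [|i x y _ <-]; rewrite ?lin0 ?L_lin.
Qed.

End LinearMap.

Lemma pi_n2 g x : n2 (pi g x) = n2 x.
Proof. by rewrite /sqnorm pi_ip. Qed.

Lemma pi_nrm g x : nrm (pi g x) = nrm x.
Proof. by rewrite /ipnorm pi_ip. Qed.

(** Induction on [F]. The operators [D k] are Fourier averages of the powers of [pi a]; they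
    preserve total square norm by Parseval, and [D k y] is an eigenvector of [pi a] for [w ^- k] up
    to a boundary term. All operators commute with [pi], so composing them keeps the estimates for
    earlier elements. The functions [chi i] need not be homomorphisms, and their values off [F] are
    arbitrary. *)
Lemma spectral_resolution (F : seq G) (d : R) : 0 < d ->
  exists (I : finType) (L : I -> V -> V) (chi : I -> G -> R[i]),
  [/\ forall i a x y, L i (a *: x + y) = a *: L i x + L i y,
      forall i g x, L i (pi g x) = pi g (L i x),
      forall i g, cmod (chi i g) = 1,
      forall y, \sum_i n2 (L i y) = n2 y &
      forall a, a \in F -> forall y,
        \sum_i n2 (pi a (L i y) - chi i a *: L i y) <= d * n2 y].
Proof.
move=> d0; elim: F => [|a F [I [L [chi [Llin Lpi chi1 Lsum LF]]]]].
  exists unit, (fun=> id), (fun _ _ => 1); split => // [_ _|y]; first exact: cmod1.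
  by rewrite big_const card_unit /= addr0.
(* Each of the [N] indices [k] contributes an error of at most [4 / N ^ 2] times [n2 y]. *)
pose N := (Num.truncn (4 / d)).+1.
have Nd : 4 / N%:R <= d.
  by rewrite ler_pdivrMr ?ltr0n // mulrC -ler_pdivrMr // ltW // truncnS_gt.
have N0 : (N%:R : R[i]) != 0 by rewrite pnatr_eq0.
have [w wN] := @prim_root_exists R[i] N isT.
have w1 : cmod w = 1.
  have /eqP := congr1 (@cmod R) (prim_expr_order wN).
  by rewrite cmodX cmod1 pexpr_eq1 ?cmod_ge0 // => /eqP.
have wX n : cmod (w ^+ n) = 1 by rewrite cmodX w1 expr1n.
have w_neq0 : w != 0 by apply: contra_eq_neq w1 => ->; rewrite cmod0 eq_sym oner_neq0.
pose D (k : 'I_N) y := N%:R^-1 *: \sum_(n < N) w ^+ (k * n) *: pi (a *+ n) y.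
have Dsum y : \sum_k n2 (D k y) = n2 y.
  rewrite (eq_bigr (fun k : 'I_N => N%:R^-1 ^+ 2 *
     n2 (\sum_(n < N) w ^+ (k * n) *: pi (a *+ n) y))); last first.
    by move=> k _; rewrite (n2Z ipP) cmodV cmod_nat.
  rewrite -mulr_sumr (n2_dft ipP) //.
  under eq_bigr do rewrite pi_n2.
  rewrite sumr_const card_ord -[n2 y *+ N]mulr_natl expr2 -!mulrA.
  by rewrite !mulKf // pnatr_eq0.
have Dlin k b x y : D k (b *: x + y) = b *: D k x + D k y.
  rewrite /D scalerA [b * _]mulrC -scalerA -scalerDr; congr (_ *: _).
  rewrite scaler_sumr -big_split; apply: eq_bigr => n _ /=.
  by rewrite pi_lin scalerDr !scalerA [b * _]mulrC.
have Dpi k g x : D k (pi g x) = pi g (D k x).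
  rewrite /D (linZ (pi_lin g)) (lin_sumZ (pi_lin g)); congr (_ *: _).
  by apply: eq_bigr => n _; rewrite -!piM addrC.
(* Applying [pi a] shifts the sum by one index, so the difference telescopes to its two ends. *)
have Da k y : pi a (D k y) - w ^- k *: D k y =
    w ^- k *: (N%:R^-1 *: (pi (a *+ N) y - y)).
  have wk : w ^+ k != 0 by rewrite expf_neq0.
  have wK (x : V) : w ^+ k *: (w ^- k *: x) = x by rewrite scalerA divff // scale1r.
  apply: (scalerI wk); rewrite scalerBr !wK.
  rewrite /D (linZ (pi_lin a)) (lin_sumZ (pi_lin a)).
  rewrite scalerA [w ^+ k * _]mulrC -scalerA -scalerBr; congr (_ *: _).
  rewrite scaler_sumr -sumrB.
  pose f n := w ^+ (k * n) *: pi (a *+ n) y.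
  rewrite (eq_bigr (fun n : 'I_N => f n.+1 - f n)); last first.
    by move=> n _; rewrite /f scalerA -exprD -mulnS -piM -mulrS.
  rewrite -(big_mkord xpredT (fun n => f n.+1 - f n)) telescope_sumr // /f.
  by rewrite mulnC exprM (prim_expr_order wN) expr1n muln0 expr0 mulr0n pi0 !scale1r.
exists (I * 'I_N)%type, (fun (p : I * 'I_N) x => L p.1 (D p.2 x)),
  (fun (p : I * 'I_N) g => if g == a then w ^- p.2 else chi p.1 g).
split=> [[i k] b x y|[i k] g x|[i k] g|y|b].
- by rewrite Dlin Llin.
- by rewrite Dpi Lpi.
- by case: eqP => // _; rewrite cmodV wX invr1.
- rewrite -(pair_big xpredT xpredT (fun i k => n2 (L i (D k y)))) exchange_big /=.
  by under eq_bigr do rewrite Lsum.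
rewrite in_cons => bF y.
rewrite -(pair_big xpredT xpredT (fun i k => n2 (pi b (L i (D k y)) -
   (if b == a then w ^- k else chi i b) *: L i (D k y)))) exchange_big /=.
move: bF; case: eqP => [->|/eqP ba] /= bF.
  apply: le_trans (_ : \sum_(k < N) 4 / N%:R / N%:R * n2 y <= _); last first.
    have -> : \sum_(k < N) 4 / N%:R / N%:R * n2 y = 4 / N%:R * n2 y.
      by rewrite sumr_const card_ord -[LHS]mulr_natr; field; rewrite pnatr_eq0.
    by apply: ler_wpM2r; [exact: n2_ge0|exact: Nd].
  apply: ler_sum => k _.
  rewrite (eq_bigr (fun i => n2 (L i (pi a (D k y) - w ^- k *: D k y)))); last first.
    by move=> i _; rewrite (linB (Llin i)) (linZ (Llin i) (w ^- k)) Lpi.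
  rewrite Lsum Da !(n2Z ipP) !cmodV wX cmod_nat invr1 expr1n mul1r expr2 -mulrA.
  rewrite [4 / _]mulrC -!mulrA ler_wpM2l // [4 * _]mulrC -mulrA ler_wpM2l //.
  have := n2_le2 ipP (pi (a *+ N) y) (- y); rewrite n2N // pi_n2; lra.
apply: le_trans (_ : \sum_(k < N) d * n2 (D k y) <= _).
  by apply: ler_sum => k _; apply: LF.
by rewrite -mulr_sumr Dsum.
Qed.

End Representation.

(** * Finite approximations of spectral measures *)

Section SpectralMeasure.
Variables (R : realType) (G : topologicalZmodType).
Variables (V : lmodType R[i]) (ip : V -> V -> R[i]) (pi : G -> V -> V).
Hypothesis ipP : is_inner_product ip.
Hypothesis piP : is_unitary_rep ip pi.
Local Notation nrm := (ipnorm ip).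
Local Notation n2 := (sqnorm ip).

(** A trigonometric polynomial as a function of [X]; [trig_op] is the operator obtained by putting
    [pi (h j)] for [X (h j)]. *)
Definition trig (J : finType) (b : R[i]) (a : J -> R[i]) (h : J -> G)
  (X : G -> R[i]) : R[i] := b + \sum_j a j * X (h j).
Definition trig_op (J : finType) (b : R[i]) (a : J -> R[i]) (h : J -> G) (y : V) : V :=
  b *: y + \sum_j a j *: pi (h j) y.
Definition trig_cst (J : finType) (a : J -> R[i]) : R :=
  #|J|%:R * \sum_j cmod (a j) ^+ 2.

(** An exact spectral measure would give equality between the integral of the squared modulus of
    [trig] and the square norm of [trig_op]. The factors 2 come from [n2_le2] and are harmless,
    since only thresholds matter later. *)
Definition spectral_measure (F : seq G) (d : R) (y : V) (m : fmeas R (G -> R[i])) :=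
  [/\ fm_prob m, forall i g, cmod (fm_pt m i g) = 1,
    forall (J : finType) b (a : J -> R[i]) h, (forall j, h j \in F) ->
      fm_E m (fun X => cmod (trig b a h X) ^+ 2) <=
        2 * n2 (trig_op b a h y) + 2 * (trig_cst a * d) /\
      n2 (trig_op b a h y) <=
        2 * fm_E m (fun X => cmod (trig b a h X) ^+ 2) + 2 * (trig_cst a * d) &
    forall a b, a \in F -> b \in F -> a + b \in F ->
      fm_E m (fun X => cmod (X (a + b) - X a * X b) ^+ 2) <= 12 * d].

Lemma spectral_measure_ex F d y : 0 < d -> n2 y = 1 ->
  exists m, spectral_measure F d y m.
Proof.
move=> d0 y1; have [I [L [chi [Llin Lpi chi1 Lsum LF]]]] :=
  spectral_resolution ipP piP F d0.
exists (@FMeas R _ I (fun i => n2 (L i y)) chi); split => /=.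
- by split => [i|] /=; [exact: n2_ge0|rewrite Lsum].
- exact: chi1.
- move=> J b a h hF.
  (* The error made when [pi (h j)] is replaced by the scalar [chi i (h j)] on [L i y]; the measure
     gives [chi i] the mass [n2 (L i y)]. *)
  pose rem i : V := \sum_j a j *: (pi (h j) (L i y) - chi i (h j) *: L i y).
  have remE i : L i (trig_op b a h y) = trig b a h (chi i) *: L i y + rem i.
    rewrite /trig_op (Llin i) (lin_sumZ (Llin i)) /trig scalerDl -addrA.
    congr (_ + _); rewrite scaler_suml -big_split; apply: eq_bigr => j _ /=.
    by rewrite Lpi scalerBr scalerA addrC subrK.
  have rem_le : \sum_i n2 (rem i) <= trig_cst a * d.
    apply: le_trans (ler_sum _ (fun i _ => n2_sumZ ipP a _)) _.
    rewrite -mulr_sumr /trig_cst -mulrA ler_wpM2l // exchange_big mulr_suml.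
    apply: ler_sum => j _ /=; rewrite -mulr_sumr ler_wpM2l ?sqr_ge0 //.
    by have := LF _ (hF j) y; rewrite y1 mulr1.
  split; rewrite /fm_E /=.
  + apply: le_trans (_ : \sum_i (2 * n2 (L i (trig_op b a h y)) + 2 * n2 (rem i)) <= _).
      apply: ler_sum => i _; rewrite mulrC -(n2Z ipP).
      have -> : trig b a h (chi i) *: L i y = L i (trig_op b a h y) - rem i.
        by rewrite remE addrK.
      by rewrite (le_trans (n2_le2 ipP _ _)) // n2N.
    by rewrite big_split -!mulr_sumr Lsum lerD2l ler_wpM2l.
  + rewrite -Lsum; apply: le_trans (_ : \sum_i (2 * (n2 (L i y) *
      cmod (trig b a h (chi i)) ^+ 2) + 2 * n2 (rem i)) <= _).
      apply: ler_sum => i _; rewrite remE mulrC -[X in _ <= X * 2 + _](mulrC (cmod _ ^+ 2)).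
      by rewrite -(n2Z ipP) mulrC (le_trans (n2_le2 ipP _ _)).
    by rewrite big_split -!mulr_sumr lerD2l ler_wpM2l.
- move=> a b aF bF abF.
  pose r u i := n2 (pi u (L i y) - chi i u *: L i y).
  have rF u : u \in F -> \sum_i r u i <= d by move=> uF; have := LF _ uF y; rewrite y1 mulr1.
  apply: le_trans (_ : \sum_i (4 * r (a + b) i + 4 * r b i + 4 * r a i) <= _); last first.
    by rewrite !big_split -!mulr_sumr /=; have := rF _ aF; have := rF _ bF; have := rF _ abF; lra.
  apply: ler_sum => i _ /=; rewrite mulrC -(n2Z ipP).
  pose ra := pi a (L i y) - chi i a *: L i y; pose rb := pi b (L i y) - chi i b *: L i y.
  pose rab := pi (a + b) (L i y) - chi i (a + b) *: L i y.
  (* The multiplicativity defect is a combination of the three eigenvector defects, because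
     [pi (a + b)] is [pi a] after [pi b]. *)
  have -> : (chi i (a + b) - chi i a * chi i b) *: L i y =
      - rab + pi a rb + chi i b *: ra.
    rewrite /rab /ra /rb (linB (pi_lin piP a)) (linZ (pi_lin piP a)) -(piM piP).
    rewrite scalerBr scalerA scalerBl [chi i b * _]mulrC opprB.
    rewrite -!addrA; congr (_ + _); rewrite !addrA addNr add0r.
    by rewrite addNr add0r.
  have := n2_le2 ipP (- rab + pi a rb) (chi i b *: ra).
  have := n2_le2 ipP (- rab) (pi a rb).
  rewrite (n2N ipP) (pi_n2 piP) (n2Z ipP) chi1 expr1n mul1r /r -/ra -/rb -/rab.
  by have := n2_ge0 ipP ra; lra.
Qed.

End SpectralMeasure.

(** * Vanishing of averages off the exceptional eigenvectors *)

Section Vanishing.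
Variables (R : realType) (G : topologicalZmodType).
Hypothesis G_lc : locally_compact [set: G].
Variables (e : nat -> G -> R[i]) (g : nat -> G).
Hypothesis Hces : forall chi : G -> R[i], is_character chi ->
  (exists n, chi = e n) \/ cesaro_to_0 g chi.
Variables (V : lmodType R[i]) (ip : V -> V -> R[i]) (pi : G -> V -> V).
Hypothesis ipP : is_inner_product ip.
Hypothesis piP : is_unitary_rep ip pi.
Local Notation nrm := (ipnorm ip).
Local Notation n2 := (sqnorm ip).

(** The filter along which [F] exhausts [G] through finite sets and the precision [1 / (m + 1)]
    tends to 0. *)
Definition late : set_system (seq G * nat) := [set A | exists (F0 : seq G) m0,
  forall (F : seq G) m, (forall x, x \in F0 -> x \in F) -> (m0 <= m)%N -> A (F, m)].

Lemma late_filter : ProperFilter late.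
Proof.
apply: Build_ProperFilter_ex.
  by move=> A [F0 [m0 A0]]; exists (F0, m0); apply: A0.
split; first by exists [::], 0%N.
  move=> A B [F [m AF]] [F' [m' BF]]; exists (F ++ F'), (maxn m m') => F2 m2 sF.
  rewrite geq_max => /andP[mm mm']; split.
    by apply: AF => // x xF; apply: sF; rewrite mem_cat xF.
  by apply: BF => // x xF; apply: sF; rewrite mem_cat xF orbT.
by move=> A B AB [F [m AF]]; exists F, m => F2 m2 ? ?; apply/AB/AF.
Qed.

Lemma small_index (K t : R) : 0 < t -> exists m0, forall m, (m0 <= m)%N ->
  K / m.+1%:R <= t.
Proof.
move=> t0; exists (Num.truncn (K / t)) => m m0m.
rewrite ler_pdivrMr ?ltr0n // mulrC -ler_pdivrMr // ltW //.
by rewrite (lt_le_trans (truncnS_gt _)) // ler_nat.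
Qed.

(** Markov's inequality for the squared modulus of [trig]; once [F] contains all [h j] and [m] is
    large, the spectral error is absorbed in [t]. *)
Lemma late_markov (mu : seq G * nat -> fmeas R (G -> R[i])) (y : V)
    (J : finType) (b : R[i]) (a : J -> R[i]) (h : J -> G) (A : set (G -> R[i])) (r t : R) :
  (forall Fm, spectral_measure ip pi Fm.1 Fm.2.+1%:R^-1 y (mu Fm)) ->
  0 < r -> 0 < t ->
  (forall X, (forall g, cmod (X g) = 1) -> A X -> r <= cmod (trig b a h X)) ->
  late [set Fm | fm_P (mu Fm) A <= 2 * n2 (trig_op pi b a h y) / r ^+ 2 + t].
Proof.
move=> muP r0 t0 Ar.
have r20 : 0 < r ^+ 2 by rewrite exprn_gt0.
have [m0 m0P] := small_index (2 * trig_cst a) (mulr_gt0 t0 r20).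
exists [seq h j | j : J], m0 => F m sF m0m /=.
have [mp m1 mE _] := muP (F, m).
have hF j : h j \in F by apply: sF; apply/mapP; eexists; rewrite ?mem_enum.
have [Ele _] := mE J b a h hF; rewrite /= in Ele.
have := @fm_markov R _ (mu (F, m)) A (fun X => cmod (trig b a h X) ^+ 2) (r ^+ 2) mp.
move=> /(_ (fun X => sqr_ge0 _)) M.
have {}M : r ^+ 2 * fm_P (mu (F, m)) A <= fm_E (mu (F, m)) (fun X => cmod (trig b a h X) ^+ 2).
  apply: M => i Ai; rewrite ler_pXn2r ?nnegrE ?cmod_ge0 ?(ltW r0) //.
  by apply: Ar => // u; apply: m1.
rewrite -(ler_pM2l r20) (le_trans M) // (le_trans Ele) //.
rewrite mulrDr [r ^+ 2 * (_ / _)]mulrC divfK ?gt_eqF // lerD2l mulrA [r ^+ 2 * t]mulrC.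
exact: m0P.
Qed.

(** If the averages stayed large, a limit of approximate spectral measures of [y] would satisfy
    every hypothesis of [character_of_content]: strong continuity gives concentration near 1, the
    small twisted averages give avoidance of [e j], and the large averages give the Cesaro
    condition. The resulting character contradicts [Hces]. *)
Lemma cesaro_op_vanish (y : V) : n2 y = 1 ->
  (forall j, is_character (e j) -> forall t : R, 0 < t -> exists c : fmeas R G,
    fm_prob c /\
    n2 (\sum_i ((fm_wt c i)%:C * (e j (fm_pt c i))^*%C) *: pi (fm_pt c i) y) <= t) ->
  forall d : R, 0 < d -> exists N0, forall N, (N0 <= N)%N ->
    n2 (N%:R^-1 *: \sum_(k < N) pi (g k) y) < d.
Proof.
move=> y1 erg d d0; apply: contrapT => nN.
have {nN}big n : exists2 N, (n <= N)%N & d <= n2 (N%:R^-1 *: \sum_(k < N) pi (g k) y).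
  apply: contrapT => nn; apply: nN; exists n => N nN; rewrite ltNge; apply/negP => dN.
  by apply: nn; exists N.
have /choice[mu muP] (Fm : seq G * nat) : exists m,
    spectral_measure ip pi Fm.1 Fm.2.+1%:R^-1 y m.
  by apply: spectral_measure_ex; rewrite // invr_gt0 ltr0n.
have [p [pC p_le p_ge]] := limit_content late_filter (fun Fm =>
  let: And4 mp _ _ _ := muP Fm in mp).
have p_markov (J : finType) (b : R[i]) (a : J -> R[i]) (h : J -> G) (A : set (G -> R[i])) (r t s : R) :
    0 < r -> 0 < t ->
    (forall X, (forall g, cmod (X g) = 1) -> A X -> r <= cmod (trig b a h X)) ->
    2 * n2 (trig_op pi b a h y) / r ^+ 2 + t <= s -> p A <= s.
  move=> r0 t0 Ar ts; apply: p_le; have [F0 [m0 late_m]] := late_markov muP r0 t0 Ar.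
  by exists F0, m0 => F m sF m0m; apply: le_trans ts; apply: late_m.
have [] := @character_of_content R G G_lc p (d / 4) (Num.sqrt (d / 8)) e g pC.
- by rewrite divr_gt0.
- by rewrite sqrtr_gt0 divr_gt0.
- apply: p_le; exists [::], 0%N => F m _ _ /=; rewrite /fm_P /fm_E big1 // => i _.
  have [_ m1 _ _] := muP (F, m).
  by rewrite asboolF ?mulr0 // => -[x]; rewrite m1 eqxx.
- move=> a b r r0; apply/ler_addgt0Pr => t t0; rewrite add0r.
  have r20 : 0 < r ^+ 2 by rewrite exprn_gt0.
  have [m0 m0P] := small_index 12 (mulr_gt0 t0 r20).
  apply: p_le; exists [:: a; b; a + b], m0 => F m sF m0m /=.
  have [mp _ _ mM] := muP (F, m).
  have {}mM : fm_E (mu (F, m)) (fun X => cmod (X (a + b) - X a * X b) ^+ 2) <= 12 / m.+1%:R.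
    by apply: mM; apply: sF; rewrite !inE eqxx ?orbT.
  have M := @fm_markov R _ (mu (F, m)) [set X | r <= cmod (X (a + b) - X a * X b)]
    (fun X => cmod (X (a + b) - X a * X b) ^+ 2) (r ^+ 2) mp (fun X => sqr_ge0 _).
  rewrite -(ler_pM2l r20) [r ^+ 2 * t]mulrC (le_trans _ (m0P m m0m)) //.
  apply: le_trans mM; apply: M => i /= Ai.
  by rewrite ler_pXn2r ?nnegrE ?cmod_ge0 ?(ltW r0).
(* With threshold 1/2, Markov costs [8 * s ^+ 2], that is half of the allowed [theta / 8] for
   [theta = d / 4]; the slack [t] takes the other half. *)
- pose s := Num.sqrt (d / 4 / 128).
  have s0 : 0 < s by rewrite sqrtr_gt0 !divr_gt0.
  exists [set u | nrm (pi u y - y) < s].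
    by have := pi_cont piP y 0 s0; rewrite (pi0 piP).
  move=> c [c0 c1] cK.
  apply: (@p_markov _ (-1) (fun i => (fm_wt c i)%:C) (fm_pt c) _ (1 / 2) (d / 4 / 16)).
  + by rewrite divr_gt0.
  + by rewrite !divr_gt0.
  + by move=> X _; rewrite /trig /fm_C addrC.
  suff : n2 (trig_op pi (-1) (fun i => (fm_wt c i)%:C) (fm_pt c) y) <= d / 4 / 128 by lra.
  have -> : d / 4 / 128 = s ^+ 2 by rewrite sqr_sqrtr // ltW // !divr_gt0.
  rewrite -(nrm_sqr ipP) ler_pXn2r ?nnegrE ?nrm_ge0 ?(ltW s0) //.
  have -> : trig_op pi (-1) (fun i => (fm_wt c i)%:C) (fm_pt c) y =
      \sum_i (fm_wt c i)%:C *: (pi (fm_pt c i) y - y).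
    under [RHS]eq_bigr do rewrite scalerBr.
    by rewrite sumrB -scaler_suml -rmorph_sum c1 scale1r /trig_op scaleN1r addrC.
  rewrite (le_trans (nrm_sum ipP _)) // -[leRHS]mul1r -c1 mulr_suml ler_sum // => i _.
  by rewrite (nrmZ ipP) cmod_real ger0_norm // ler_wpM2l // ltW //; apply: cK.
(* If [X] is within 1/2 of [e j] on the support of [c], the twisted average of [X] is within 1/2 of
   1, hence at least 1/2; Markov turns the bound [q / 16] into [q / 2]. *)
- move=> j ej; set q := d / 4 / 16 / 2 ^+ j.
  have q0 : 0 < q by rewrite !divr_gt0 // exprn_gt0.
  have q16 : 0 < q / 16 by rewrite divr_gt0.
  have [c [[c0 c1] cy]] := erg j ej _ q16.
  exists [seq fm_pt c i | i : fm_idx c], (1 / 2); split; first by rewrite divr_gt0.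
  apply: (@p_markov _ 0 (fun i => (fm_wt c i)%:C * (e j (fm_pt c i))^*%C) (fm_pt c) _
    (1 / 2) (q / 2)); rewrite ?divr_gt0 //.
    move=> X X1 XH; rewrite /trig add0r.
    have e1 x : cmod (e j x) = 1 by have := ej.1 x; rewrite normC_cmod => -[].
    set S := \sum_i _.
    have : cmod (S - 1) <= 1 / 2.
      have -> : S - 1 = \sum_i (fm_wt c i)%:C * ((e j (fm_pt c i))^*%C *
          (X (fm_pt c i) - e j (fm_pt c i))).
        rewrite -[1](rmorph1 (real_complex R)) -c1 rmorph_sum -sumrB.
        apply: eq_bigr => i _; rewrite [in RHS]mulrBr mulrBr mulrA; congr (_ - _).
        by rewrite [_^*%C * _]mulrC conj_unit // mulr1.
      apply: le_trans (cmod_sum _ _) _.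
      apply: le_trans (_ : \sum_i fm_wt c i * (1 / 2) <= _); last first.
        by rewrite -mulr_suml c1 mul1r.
      apply: ler_sum => i _.
      rewrite !cmodM cmod_conj e1 mul1r cmod_real ger0_norm // ler_wpM2l // ltW //.
      by apply: XH; apply/mapP; exists i; rewrite ?mem_enum.
    by have := cmodB S (S - 1); rewrite subKr cmod1; lra.
  by rewrite /trig_op scale0r add0r; lra.
- move=> n; have [N nN dN] := big n; exists N => //.
  have d8 : 0 < d / 8 by rewrite divr_gt0.
  pose a (k : 'I_N) : R[i] := N%:R^-1; pose h (k : 'I_N) := g k.
  have [m0 m0P] := small_index (trig_cst a) d8.
  apply: p_ge; exists [seq h k | k : 'I_N], m0 => F m sF m0m /=.
  have [mp m1 mE _] := muP (F, m).
  have [|_ Ege] := mE _ 0 a h; first by move=> j; apply: sF; apply/mapP; eexists; rewrite ?mem_enum.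
  have opE : trig_op pi 0 a h y = N%:R^-1 *: \sum_(k < N) pi (g k) y.
    by rewrite /trig_op scale0r add0r scaler_sumr.
  have trE X : trig 0 a h X = cesaro g N X by rewrite /trig add0r /cesaro mulr_sumr.
  rewrite opE /= in Ege; have Kd := m0P m m0m.
  set A := [set X | _ <= _].
  (* Off [A] the squared mean is at most [d / 8], and on [A] at most 1. Combined with [Ege] this
     leaves mass at least [d / 4] for [A]. *)
  have : fm_E (mu (F, m)) (fun X => cmod (trig 0 a h X) ^+ 2) <= d / 8 + fm_P (mu (F, m)) A.
    rewrite -[d / 8](fm_E_cst _ mp) -fm_ED; apply: fm_E_le => // i; rewrite trE.
    have [Ai|nA] := asboolP (A _).
      apply: le_trans (_ : 1 <= _); last by rewrite lerDr ltW.
      rewrite expr_le1 ?cmod_ge0 //.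
      have := @cesaro_dist R G g N (fm_pt (mu (F, m)) i) (fun=> 0) 1.
      rewrite {2}/cesaro big1 // mulr0 subr0; apply => // k _.
      by rewrite subr0 m1.
    rewrite addr0 -[d / 8]sqr_sqrtr ?(ltW d8) // ler_pXn2r ?nnegrE ?cmod_ge0 ?sqrtr_ge0 //.
    by rewrite leNgt; apply/negP => lt; apply: nA; rewrite /A /= ltW.
  set E0 := fm_E _ _ in Ege *; set P0 := fm_P _ _ => EP.
  have h1 : d <= 2 * E0 + 2 * (d / 8).
    by rewrite (le_trans dN) // (le_trans Ege) // lerD2l ler_wpM2l.
  lra.
- move=> chi [chiC nE nC]; have [[j /nE//]|//] := Hces chiC.
Qed.

End Vanishing.

(** * Eigenvectors of nearly invariant vectors *)

Section HilbertProjection.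
Variables (R : realType) (V : lmodType R[i]) (ip : V -> V -> R[i]).
Hypothesis ipP : is_inner_product ip.
Hypothesis ipK : ip_complete ip.
Local Notation nrm := (ipnorm ip).
Local Notation n2 := (sqnorm ip).

Lemma nrm_lt_sqr (x : V) (r : R) : 0 <= r -> (nrm x < r) = (n2 x < r ^+ 2).
Proof. by move=> r0; rewrite -(nrm_sqr ipP) ltr_pXn2r ?nnegrE ?nrm_ge0. Qed.

Lemma nrm_le_sqr (x : V) (r : R) : 0 <= r -> (nrm x <= r) = (n2 x <= r ^+ 2).
Proof. by move=> r0; rewrite -(nrm_sqr ipP) ler_pXn2r ?nnegrE ?nrm_ge0. Qed.

Lemma n2_half (u v : V) : n2 (2^-1 *: (u + v)) = n2 (u + v) / 4.
Proof. by rewrite (n2Z ipP) cmodV (cmod_nat R 2); field. Qed.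

(** A minimising sequence in a midpoint-convex set is Cauchy by the parallelogram law. Its limit [z]
    need not lie in [C], so approximating elements of [C] are returned with it. *)
Lemma almost_min (C : set V) : C !=set0 ->
  (forall u v, C u -> C v -> C (2^-1 *: (u + v))) ->
  exists (z : V) (d : R), (forall v, C v -> d <= n2 v) /\
    forall r, 0 < r -> exists v, [/\ C v, nrm (v - z) < r & n2 v < d + r ^+ 2].
Proof.
move=> [c0 Cc0] Chalf; have [d dE] : exists d, d = inf [set n2 v | v in C] by eexists.
have hi : has_inf [set n2 v | v in C].
  split; first by exists (n2 c0), c0.
  by exists 0 => _ [v _ <-]; apply: n2_ge0.
have dP v : C v -> d <= n2 v by move=> Cv; rewrite dE; apply: ge_inf; [exact: hi.2|exists v].
have near_d r : 0 < r -> exists2 v, C v & n2 v < d + r.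
  by move=> r0; rewrite dE; have [_ [v Cv <-] lt] := inf_adherent r0 hi; exists v.
have /choice[u uP] n : exists v, C v /\ n2 v < d + n.+1%:R^-1.
  have n0 : 0 < n.+1%:R^-1 :> R by rewrite invr_gt0 ltr0n.
  by have [v Cv lt] := near_d _ n0; exists v.
have dist m n : n2 (u m - u n) <= 2 / m.+1%:R + 2 / n.+1%:R.
  have [Cm um] := uP m; have [Cn un] := uP n.
  have := n2_parallelogram ipP (u m) (u n).
  have := dP _ (Chalf _ _ Cm Cn); rewrite n2_half.
  move: um un; move: (m.+1%:R^-1) (n.+1%:R^-1) => a b; lra.
have small r : 0 < r -> exists N, forall n, (N <= n)%N -> 4 / n.+1%:R < r ^+ 2 :> R.
  move=> r0; have r20 : 0 < r ^+ 2 / 2 by rewrite divr_gt0 ?exprn_gt0.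
  have [N NP] := small_index 4 r20; exists N => n /NP h.
  by rewrite (le_lt_trans h) // ltr_pdivrMr // ltr_pMr ?exprn_gt0 ?ltr1n.
have [z zP] : exists z, forall r, 0 < r -> exists N, forall n, (N <= n)%N -> nrm (u n - z) < r.
  apply: ipK => r r0; have [N NP] := small r r0; exists N => m n Nm Nn.
  rewrite nrm_lt_sqr ?ltW // (le_lt_trans (dist m n)) //.
  by move: (NP m Nm) (NP n Nn); move: (m.+1%:R^-1) (n.+1%:R^-1) => a b; lra.
exists z, d; split=> // r r0.
have [N1 N1P] := zP r r0; have [N2 N2P] := small r r0.
pose n := maxn N1 N2; have [Cn un] := uP n; exists (u n); split => //.
  by apply: N1P; rewrite leq_maxl.
have := N2P n (leq_maxr _ _); have : 0 < n.+1%:R^-1 :> R by rewrite invr_gt0 ltr0n.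
by move: un; move: (n.+1%:R^-1) => a; lra.
Qed.

Lemma nrm_eq0_eps (x : V) : (forall r, 0 < r -> nrm x <= r) -> x = 0.
Proof.
move=> xr; apply: (nrm_eq0 ipP); apply/eqP.
by rewrite eq_le nrm_ge0 andbT; apply/ler_addgt0Pr => r r0; rewrite add0r xr.
Qed.

(** [W] is not assumed closed, so only the orthogonal component [y] is exact: it is the limit of
    near-minimisers of the norm on [x - W], and moving such a point along [v] bounds its inner
    product with [v]. *)
Lemma orthogonal_projection (W : set V) (x : V) : W 0 ->
  (forall a u v, W u -> W v -> W (a *: u + v)) ->
  exists y, (forall v, W v -> ip y v = 0) /\
    forall r, 0 < r -> exists2 z, W z & nrm (x - z - y) < r.
Proof.
move=> W0 Wlin; have WZ a u : W u -> W (a *: u).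
  by move=> Wu; rewrite -[a *: u]addr0; apply: Wlin.
have WD u v : W u -> W v -> W (u + v).
  by move=> Wu Wv; rewrite -[u]scale1r; apply: Wlin.
pose C := [set x - z | z in W].
have [||y [d [dP yP]]] := @almost_min C.
- by exists (x - 0), 0.
- move=> _ _ [u Wu <-] [v Wv <-]; exists (2^-1 *: (u + v)); first exact/WZ/WD.
  have xx : x + x = (2 : R[i]) *: x by rewrite scaler_nat mulr2n.
  by rewrite addrACA -opprD scalerBr xx scalerA mulVf ?pnatr_eq0 // scale1r.
exists y; split; last first.
  by move=> r r0; have [_ [[z Wz <-] zr _]] := yP r r0; exists z.
move=> v Wv; apply: cmod_eq0; apply/eqP; rewrite eq_le cmod_ge0 andbT.
apply/ler_addgt0Pr => r r0; rewrite add0r.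
(* The added 1 avoids a separate case [v = 0] and gives [nrm v <= B] as well. *)
pose B := n2 v + 1; have B0 : 0 < B by rewrite ltr_wpDl ?n2_ge0.
have nB : nrm v <= B.
  have := nrm_sqr ipP v; have := nrm_ge0 ip v; rewrite /B; nra.
pose s := r / (2 * B); have s0 : 0 < s by rewrite divr_gt0 ?mulr_gt0.
have [_ [[z Wz <-] zs n2z]] := yP s s0; set w := x - z in zs n2z.
set q := ip w v.
have qs : cmod q ^+ 2 <= s ^+ 2 * B.
  pose t := B^-1%:C * q.
  have : d <= n2 (w - t *: v).
    apply: dP; exists (z + t *: v); last by rewrite opprD addrA.
    by rewrite addrC; apply: Wlin.
  have -> : n2 (w - t *: v) = n2 w - cmod q ^+ 2 / B * (2 - n2 v / B).
    rewrite (n2D ipP) (n2N ipP) (n2Z ipP) (ipNr ipP) (ipZr ipP) -/q /t.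
    have -> : - ((B^-1%:C * q)^*%C * q) = (- (cmod q ^+ 2 / B))%:C.
      rewrite conjcM conjc_real -mulrA [q^*%C * q]mulrC -sqr_cmod.
      by rewrite -rmorphM -rmorphN mulrC.
    rewrite cmodM cmod_real ger0_norm ?invr_ge0 ?ltW //=; field.
    by rewrite gt_eqF.
  have vB : n2 v / B <= 1 by rewrite ler_pdivrMr // mul1r lerDl.
  have : 0 <= cmod q ^+ 2 / B by rewrite divr_ge0 ?sqr_ge0 ?ltW.
  move=> a0 da; rewrite -ler_pdivrMr //; move: a0 da.
  move: (cmod q ^+ 2 / B) (n2 v / B) vB n2z => a b b1 n2z a0.
  have : a <= a * (2 - b) by rewrite ler_peMr //; lra.
  by move: (a * (2 - b)) (s ^+ 2) n2z => a2 s2; lra.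
have qB : cmod q <= s * B.
  have sB0 : 0 <= s * B by rewrite mulr_ge0 ?ltW.
  rewrite -(@ler_pXn2r _ 2) ?nnegrE ?cmod_ge0 // (le_trans qs) // (exprMn _ s B).
  apply: ler_wpM2l; first exact: sqr_ge0.
  by rewrite expr2 ler_peMl ?(ltW B0) // lerDr n2_ge0.
have -> : ip y v = q - ip (w - y) v by rewrite (ipBl ipP) subKr.
rewrite (le_trans (cmodB _ _)) //.
have wy : cmod (ip (w - y) v) <= s * B.
  by rewrite (le_trans (cauchy_schwarz ipP _ _)) // ler_pM ?nrm_ge0 ?(ltW zs).
have -> : r = s * B + s * B by rewrite /s; field; rewrite gt_eqF.
exact: lerD.
Qed.

End HilbertProjection.

(** * The mean ergodic theorem *)

Section MeanErgodic.
Variables (R : realType) (G : topologicalZmodType).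
Variables (V : lmodType R[i]) (ip : V -> V -> R[i]) (pi : G -> V -> V).
Hypothesis ipH : is_hilbert ip.
Hypothesis piP : is_unitary_rep ip pi.
Local Notation nrm := (ipnorm ip).
Local Notation n2 := (sqnorm ip).
Let ipP := ipH.1.

Definition eigen (chi : G -> R[i]) (w : V) := forall g, pi g w = chi g *: w.

(** In the convex hull of the orbit of [y] under the twisted action [tw], the limit [z] of
    near-minimisers is fixed by [tw] by the parallelogram law, so it is a [chi]-eigenvector. Then
    [y], hence the whole hull, is orthogonal to [z], and [z], approximated from the hull, is 0. *)
Lemma mean_ergodic (chi : G -> R[i]) (y : V) :
  (forall g, cmod (chi g) = 1) -> (forall g h, chi (g + h) = chi g * chi h) ->
  (forall w, eigen chi w -> ip y w = 0) ->
  forall t : R, 0 < t -> exists c : fmeas R G, fm_prob c /\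
    n2 (\sum_i ((fm_wt c i)%:C * (chi (fm_pt c i))^*%C) *: pi (fm_pt c i) y) <= t.
Proof.
move=> chi1 chiD yperp t t0.
pose av (c : fmeas R G) := \sum_i ((fm_wt c i)%:C * (chi (fm_pt c i))^*%C) *: pi (fm_pt c i) y.
pose C := [set v | exists2 c, fm_prob c & v = av c].
have Chalf u v : C u -> C v -> C (2^-1 *: (u + v)).
  move=> [c [c0 c1] ->] [c' [c'0 c'1] ->].
  pose m := @FMeas R G (fm_idx c + fm_idx c')%type
    (fun i => match i with inl j => fm_wt c j / 2 | inr j => fm_wt c' j / 2 end)
    (fun i => match i with inl j => fm_pt c j | inr j => fm_pt c' j end).
  exists m.
    split=> [[j|j]|]; rewrite /= ?divr_ge0 //.
    by rewrite big_sumType /= -!mulr_suml c1 c'1; field.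
  rewrite /av big_sumType /= scalerDr !scaler_sumr; congr (_ + _);
    by apply: eq_bigr => j _; rewrite scalerA mulrA rmorphM fmorphV rmorph_nat [2^-1 * _]mulrC.
have C0 : C !=set0.
  pose m := @FMeas R G unit (fun=> 1) (fun=> 0).
  exists (av m), m => //; split => //=.
  by rewrite big_const card_unit /= addr0.
pose tw g v := (chi g)^*%C *: pi g v.
have Ctw g v : C v -> C (tw g v).
  move=> [c [c0 c1] ->].
  exists (@FMeas R G (fm_idx c) (fm_wt c) (fun i => g + fm_pt c i)); first by split.
  rewrite /tw /av (lin_sumZ (pi_lin piP g)) scaler_sumr; apply: eq_bigr => i _ /=.
  by rewrite scalerA (piM piP) chiD conjcM; congr (_ *: _); ring.
have tw_nrm g v : nrm (tw g v) = nrm v.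
  by rewrite (nrmZ ipP) cmod_conj chi1 mul1r (pi_nrm piP).
have tw_n2 g v : n2 (tw g v) = n2 v by rewrite -!(nrm_sqr ipP) tw_nrm.
have twB g u v : tw g (u - v) = tw g u - tw g v.
  by rewrite /tw (linB (pi_lin piP g)) scalerBr.
have [z [d [dP zP]]] := almost_min ipP ipH.2 C0 Chalf.
have tw_z g : tw g z = z.
  apply/eqP; rewrite -subr_eq0; apply/eqP/(nrm_eq0_eps ipP) => r r0.
  have r4 : 0 < r / 4 by rewrite divr_gt0.
  have [v [Cv vz vd]] := zP _ r4.
  have h1 : nrm (tw g v - v) <= 2 * (r / 4).
    have r20 : 0 <= 2 * (r / 4) by lra.
    rewrite (nrm_le_sqr ipP _ r20) exprMn.
    have := n2_parallelogram ipP (tw g v) v; rewrite tw_n2.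
    have := dP _ (Chalf _ _ (Ctw g v Cv) Cv); rewrite (n2_half ipP).
    by move: ((r / 4) ^+ 2) vd => r2; rewrite expr2; lra.
  have h2 : nrm (tw g z - tw g v) < r / 4 by rewrite -twB tw_nrm (nrmC ipP).
  have := nrm_tri ipP (tw g v) (tw g z) z; have := nrm_tri ipP v (tw g v) z; lra.
have z_eig : eigen chi z.
  by move=> g; rewrite -[in RHS](tw_z g) scalerA conj_unit // scale1r.
have yz := yperp z z_eig.
have Cz v : C v -> ip v z = 0.
  move=> [c _ ->]; rewrite (ip_suml ipP) big1 // => i _; rewrite (ipZl ipP).
  by rewrite -[X in ip _ X](tw_z (fm_pt c i)) (ipZr ipP) (pi_ip piP) yz !mulr0.
have z0 : z = 0.
  apply: (nrm_eq0_eps ipP) => r r0; have [v [Cv vz _]] := zP r r0.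
  have : n2 z <= r * nrm z.
    rewrite -[n2 z]ger0_norm ?(n2_ge0 ipP) // -cmod_real -(ipE ipP) -cmodN.
    have -> : - ip z z = ip (v - z) z by rewrite (ipBl ipP) (Cz v Cv) sub0r.
    rewrite (le_trans (cauchy_schwarz ipP _ _)) // ler_wpM2r ?nrm_ge0 //.
    exact: ltW.
  rewrite -(nrm_sqr ipP) expr2; have := nrm_ge0 ip z; rewrite le0r => /orP[/eqP->|z_gt0].
    by move=> _; apply: ltW.
  by rewrite ler_pM2r.
have st : 0 < Num.sqrt t by rewrite sqrtr_gt0.
have [v [[c c1 ->] vz _]] := zP _ st.
exists c; split => //; move: vz.
by rewrite z0 subr0 (nrm_lt_sqr ipP _ (ltW st)) sqr_sqrtr ?(ltW t0) // => /ltW.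
Qed.

Lemma eigen_orthogonal (chi psi : G -> R[i]) (v w : V) : (forall g, cmod (psi g) = 1) ->
  eigen chi v -> eigen psi w -> chi <> psi -> ip v w = 0.
Proof.
move=> psi1 vE wE chi_psi.
have [h chih] : exists h, chi h <> psi h.
  apply: contrapT => nh; apply: chi_psi; apply/funext => h.
  by apply: contrapT => ch; apply: nh; exists h.
have : ip v w = chi h * (psi h)^*%C * ip v w.
  by rewrite -[LHS](pi_ip piP h) vE wE (ipZl ipP) (ipZr ipP) mulrA.
move/eqP; rewrite -subr_eq0 -[X in X - _]mul1r -mulrBl mulf_eq0 => /orP[|/eqP//].
rewrite subr_eq0 => /eqP c1; exfalso; apply: chih.
by rewrite -[LHS]mulr1 -(conj_unit (psi1 h)) [psi h * _]mulrC mulrA -c1 mul1r.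
Qed.

Lemma n2_orthogonal_sum (n : nat) (v : 'I_n -> V) :
  (forall i j, i != j -> ip (v i) (v j) = 0) -> n2 (\sum_i v i) = \sum_i n2 (v i).
Proof.
move=> vo; apply: complexI; rewrite -(ipE ipP) (ip_suml ipP) rmorph_sum /=.
apply: eq_bigr => i _; rewrite (ip_sumr ipP) (bigD1 i) //= big1 ?addr0 ?(ipE ipP) //.
by move=> j ji; apply: vo; rewrite eq_sym.
Qed.

End MeanErgodic.

(** * From nearly invariant vectors to measures on characters *)

Section EigenMeasure.
Variables (R : realType) (G : topologicalZmodType).
Hypothesis G_lc : locally_compact [set: G].
Variables (e : nat -> G -> R[i]) (g : nat -> G).
Hypothesis Hces : forall chi : G -> R[i], is_character chi ->
  (exists n, chi = e n) \/ cesaro_to_0 g chi.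
Variables (V : lmodType R[i]) (ip : V -> V -> R[i]) (pi : G -> V -> V).
Hypothesis ipH : is_hilbert ip.
Hypothesis piP : is_unitary_rep ip pi.
Local Notation nrm := (ipnorm ip).
Local Notation n2 := (sqnorm ip).
Let ipP := ipH.1.

(** The enumeration [e] may repeat and may contain functions that are not characters; [good] keeps
    the first occurrence of each character, so that distinct indices carry orthogonal
    eigenvectors. *)
Let good j := is_character (e j) /\ forall i, (i < j)%N -> e i <> e j.

Let span : set V := [set z | exists (n : nat) (v : nat -> V),
  [/\ forall j, eigen pi (e j) (v j), forall j, ~ good j -> v j = 0 &
      z = \sum_(j < n) v j]].

Let avg N x := N%:R^-1 *: \sum_(k < N) pi (g k) x.

Let span0 : span 0.
Proof.
exists 0%N, (fun=> 0); split => // [j u|]; last by rewrite big_ord0.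
by rewrite scaler0 (lin0 (pi_lin piP u)).
Qed.

Let span_lin a u v : span u -> span v -> span (a *: u + v).
Proof.
move=> [n [x [xe xg ->]]] [m [y [ye yg ->]]].
exists (maxn n m), (fun j => a *: (if (j < n)%N then x j else 0) +
  (if (j < m)%N then y j else 0)); split => [j u'|j jg|].
- rewrite (pi_lin piP) scalerDr !scalerA [_ * a]mulrC -scalerA.
  by congr (_ *: _ + _); case: ifP => _; rewrite ?xe ?ye ?scaler0 ?(lin0 (pi_lin piP u')).
- by rewrite xg // yg // !if_same scaler0 addr0.
rewrite big_split -scaler_sumr /= -!big_mkcond /=.
by rewrite -!big_ord_widen ?leq_maxl ?leq_maxr.
Qed.

Let span_pi u z : span z -> span (pi u z).
Proof.
move=> [n [v [ve vg ->]]]; exists n, (fun j => e j u *: v j); split => [j u'|j jg|].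
- by rewrite (linZ (pi_lin piP u')) ve !scalerA mulrC.
- by rewrite vg // scaler0.
rewrite -[in LHS](eq_bigr _ (fun (j : 'I_n) _ => scale1r (v j))).
rewrite (lin_sumZ (pi_lin piP u)); apply: eq_bigr => j _.
by rewrite scale1r ve.
Qed.

Let span_avg N z : span z -> span (avg N z).
Proof.
move=> sz; rewrite /avg -[_ *: _]addr0; apply: span_lin => //.
elim/big_ind: _ => // [u v su sv|k _]; last exact: span_pi.
by rewrite -[u]scale1r; apply: span_lin.
Qed.

Let avg_lin N a x y : avg N (a *: x + y) = a *: avg N x + avg N y.
Proof.
rewrite /avg scalerA [a * _]mulrC -scalerA -scalerDr; congr (_ *: _).
by rewrite scaler_sumr -big_split; apply: eq_bigr => k _; rewrite (pi_lin piP).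
Qed.

Let avg_le N x (r : R) : (0 < N)%N -> (forall k, nrm (pi (g k) x - x) <= r) ->
  nrm (avg N x - x) <= r.
Proof.
move=> N0 xr; have NR : (0 : R) < N%:R by rewrite ltr0n.
have -> : avg N x - x = N%:R^-1 *: \sum_(k < N) (pi (g k) x - x).
  rewrite sumrB sumr_const card_ord scalerBr -[x *+ N]scaler_nat scalerA mulVf ?scale1r //.
  by rewrite pnatr_eq0 -lt0n.
rewrite (nrmZ ipP) cmodV cmod_nat mulrC ler_pdivrMr // (le_trans (nrm_sum ipP _)) //.
by rewrite mulr_natr -[X in _ *+ X]card_ord -sumr_const ler_sum.
Qed.

Let avg_nrm N x : nrm (avg N x) <= nrm x.
Proof.
case: N => [|N]; first by rewrite /avg big_ord0 scaler0 (nrm0 ipP) nrm_ge0.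
rewrite (nrmZ ipP) cmodV cmod_nat mulrC ler_pdivrMr ?ltr0n //.
rewrite (le_trans (nrm_sum ipP _)) // mulr_natr -[X in _ *+ X]card_ord -sumr_const.
by rewrite ler_sum // => k _; rewrite (pi_nrm piP).
Qed.

Let perp_eigen (y : V) : (forall v, span v -> ip y v = 0) ->
  forall j, is_character (e j) -> forall w, eigen pi (e j) w -> ip y w = 0.
Proof.
move=> ys j ej w we.
have [i [gi ei]] : exists i, good i /\ e i = e j.
  have ex : exists i, `[< e i = e j >] by exists j; apply/asboolP.
  exists (ex_minn ex); case: ex_minnP => i /asboolP ei imin; split => //.
  split; first by rewrite ei.
  move=> k ki ek; have := imin k; rewrite leqNgt ki => /(_ _)/negP; apply => //.
  by apply/asboolP; rewrite ek.
apply: ys; exists i.+1, (fun k => if k == i then w else 0); split => [k u|k|].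
- by case: eqP => [->|_]; rewrite ?ei // scaler0 (lin0 (pi_lin piP u)).
- by case: eqP => // ->.
by rewrite big_ord_recr /= eqxx big1 ?add0r // => k _; rewrite ltn_eqF.
Qed.

(* The component of [x] orthogonal to the [e j]-eigenvectors has vanishing
   averages, while the averages of [x] stay within [eps] of [x]. *)
Lemma span_dense (x : V) (eps : R) : 0 < eps ->
  (forall k, nrm (pi (g k) x - x) <= eps) ->
  exists2 z, span z & nrm (x - z) <= 3 * eps.
Proof.
move=> eps0 xeps.
have [y [yperp yP]] := orthogonal_projection ipP ipH.2 x span0 span_lin.
suff ny : nrm y <= 2 * eps.
  have [z sz zr] := yP _ eps0; exists z => //.
  have := nrmD ipP (x - z - y) y; rewrite subrK; lra.
have [y0|y_neq0] := eqVneq (nrm y) 0; first by rewrite y0 mulr_ge0 ?ltW.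
have y_gt0 : 0 < nrm y by rewrite lt_def y_neq0 nrm_ge0.
pose a : R[i] := (nrm y)^-1%:C; pose y' := a *: y.
have ca : cmod a = (nrm y)^-1 by rewrite cmod_real ger0_norm // invr_ge0 nrm_ge0.
have y'1 : n2 y' = 1 by rewrite (n2Z ipP) ca -(nrm_sqr ipP) -exprMn mulVf ?expr1n.
have e20 : 0 < (eps / 2 / nrm y) ^+ 2 by rewrite exprn_gt0 // !divr_gt0.
have y'perp j : is_character (e j) -> forall w, eigen pi (e j) w -> ip y' w = 0.
  by move=> ej w we; rewrite (ipZl ipP) (perp_eigen yperp ej we) mulr0.
have [|N0 N0P] := @cesaro_op_vanish R G G_lc e g Hces V ip pi ipP piP y' y'1 _ _ e20.
  move=> j ej t t0; apply: (mean_ergodic ipH piP) => //; last exact: y'perp.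
    by move=> u; have := ej.1 u; rewrite normC_cmod => -[].
  by move=> u v; rewrite ej.2.1.
pose N := N0.+1; have := N0P N (leqnSn _); rewrite -/(avg N y').
have e2y : 0 <= eps / 2 / nrm y by rewrite !divr_ge0 ?nrm_ge0 // ltW.
rewrite -(nrm_lt_sqr ipP _ e2y) => avN.
have avy : nrm (avg N y) < eps / 2.
  move: avN; rewrite /y' -[a *: y]addr0 avg_lin.
  have -> : avg N 0 = 0.
    by rewrite /avg big1 ?scaler0 // => k _; rewrite (lin0 (pi_lin piP _)).
  by rewrite addr0 (nrmZ ipP) ca mulrC ltr_pM2r ?invr_gt0.
have e4 : 0 < eps / 4 by rewrite divr_gt0.
have [z sz zr] := yP _ e4; pose r := x - z - y.
have xE : x = z + (y + r) by rewrite /r [y + _]addrC subrK addrC subrK.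
have zy w : span w -> ip w y = 0 by move=> sw; rewrite (ipC ipP) (yperp _ sw) conjc0.
(* Both [z] and its averages are orthogonal to [y], so the square norm of [y] is expressed through
   four small terms. *)
have n2y : (n2 y)%:C = ip (avg N y) y + ip (avg N r) y - ip r y - ip (avg N x - x) y.
  have avx : avg N x = avg N z + (avg N y + avg N r).
    by rewrite {1}xE -[z]scale1r avg_lin scale1r -[y]scale1r avg_lin !scale1r.
  have ipx : ip x y = ip y y + ip r y.
    by rewrite [in LHS]xE !(ipDl ipP) (zy _ sz) add0r.
  have ipavx : ip (avg N x) y = ip (avg N y) y + ip (avg N r) y.
    by rewrite avx !(ipDl ipP) (zy _ (span_avg N sz)) add0r.
  by rewrite -(ipE ipP) (ipBl ipP (avg N x)) ipavx ipx; ring.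
have : n2 y <= (eps / 2 + eps / 4 + eps / 4 + eps) * nrm y.
  rewrite -[n2 y]ger0_norm ?(n2_ge0 ipP) // -cmod_real n2y !mulrDl.
  have cs u s : nrm u <= s -> cmod (ip u y) <= s * nrm y.
    move=> us; rewrite (le_trans (cauchy_schwarz ipP _ _)) // ler_wpM2r ?nrm_ge0 //.
  rewrite (le_trans (cmodB _ _)) // lerD ?cs ?avg_le // (le_trans (cmodB _ _)) //.
  rewrite lerD ?cs ?(ltW zr) // (le_trans (cmodD _ _)) // lerD ?cs ?(ltW avy) //.
  by rewrite (le_trans (avg_nrm _ _)) // ltW.
rewrite -(nrm_sqr ipP) expr2 ler_pM2r // => h; apply: le_trans h _; lra.
Qed.

(** A vector [z] of [span] within [3 * eps] of [x] is a sum of orthogonal eigenvectors [v j]; the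
    measure gives [e j] the share of [v j] in [n2 z]. Without invariant vectors no trivial character
    occurs. The integral is the relative square displacement of [z]; the factor 4 comes from
    [n2 z >= 1 / 4]. *)
Lemma eigen_measure (x : V) (eps : R) : n2 x = 1 -> 0 < eps -> eps <= 1 / 12 ->
  (forall k, nrm (pi (g k) x - x) <= eps) ->
  (forall v, (forall u, pi u v = v) -> v = 0) ->
  exists m : fmeas R (G -> R[i]), [/\ fm_prob m,
    forall i, is_character (fm_pt m i) /\ exists h, fm_pt m i h <> 1 &
    forall u, fm_E m (fun X => cmod (X u - 1) ^+ 2) <=
      4 * (nrm (pi u x - x) + 6 * eps) ^+ 2].
Proof.
move=> x1 eps0 eps12 xeps noinv.
have [z [n [v [ve vg zE]]] xz] := span_dense eps0 xeps.
have nx : nrm x = 1 by rewrite /ipnorm -/(n2 x) x1 sqrtr1.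
have nz : 1 / 2 <= nrm z by have := nrmD ipP (x - z) z; rewrite subrK nx; lra.
have n2z : 1 / 4 <= n2 z.
  have -> : 1 / 4 = (1 / 2) ^+ 2 :> R by field.
  by rewrite -(nrm_sqr ipP) ler_pXn2r ?nnegrE ?nrm_ge0 // divr_ge0.
have n2z0 : 0 < n2 z by apply: lt_le_trans n2z; rewrite divr_gt0.
have vo (c : nat -> R[i]) : n2 (\sum_(j < n) c j *: v j) = \sum_(j < n) cmod (c j) ^+ 2 * n2 (v j).
  rewrite (n2_orthogonal_sum ipH); first by apply: eq_bigr => j _; rewrite (n2Z ipP).
  move=> i j ij; rewrite (ipZl ipP) (ipZr ipP).
  have [gi|/vg->] := pselect (good i); last by rewrite (ip0l ipP) !mulr0.
  have [gj|/vg->] := pselect (good j); last by rewrite (ip0r ipP) !mulr0.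
  rewrite (eigen_orthogonal ipH piP _ (ve i) (ve j)) ?mulr0 //.
    by move=> u; have := gj.1.1 u; rewrite normC_cmod => -[].
  have [ltij|ltji|/val_inj eij] := ltngtP i j; first exact: gj.2.
    by move=> /esym; apply: gi.2.
  by rewrite eij eqxx in ij.
have nontriv j : v j != 0 -> is_character (e j) /\ exists h, e j h <> 1.
  move=> vj; have gj : good j by apply: contrapT => /vg v0; rewrite v0 eqxx in vj.
  split; first exact: gj.1.
  apply: contrapT => nh; move/eqP: vj; apply; apply: noinv => u; rewrite ve.
  suff -> : e j u = 1 by rewrite scale1r.
  by apply: contrapT => ej1; apply: nh; exists u.
have sum_n2 : \sum_(j < n) n2 (v j) = n2 z.
  have := vo (fun=> 1); under eq_bigr do rewrite scale1r.
  rewrite -zE => ->; by apply: eq_bigr => j _; rewrite cmod1 expr1n mul1r.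
have [j0 vj0] : exists j0 : 'I_n, v j0 != 0.
  apply: contrapT => nj; move: n2z0; rewrite -sum_n2 big1 ?ltxx // => j _.
  have -> : v j = 0 by apply/eqP/negPn/negP => vj; apply: nj; exists j.
  by rewrite /sqnorm (ip0l ipP).
(* Indices with [v j = 0] have weight 0 but must still carry a nontrivial character; [e j0] fills
   in. *)
exists (@FMeas R _ 'I_n (fun j => n2 (v j) / n2 z)
  (fun j => if v j == 0 then e j0 else e j)); split => /=.
- by split=> [j|] /=; [rewrite divr_ge0 ?(n2_ge0 ipP)|rewrite -mulr_suml sum_n2 divff ?gt_eqF].
- by move=> j; case: ifPn => [_|]; apply: nontriv.
move=> u; rewrite /fm_E /=.
have -> : \sum_(j < n) n2 (v j) / n2 z *
    cmod ((if v j == 0 then e j0 else e j) u - 1) ^+ 2 = n2 (pi u z - z) / n2 z.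
  have -> : pi u z - z = \sum_(j < n) (e j u - 1) *: v j.
    have zZ : z = \sum_(j < n) 1 *: v j by rewrite zE; apply: eq_bigr => j _; rewrite scale1r.
    rewrite {1}zZ (lin_sumZ (pi_lin piP u)) zE -sumrB; apply: eq_bigr => j _.
    by rewrite scale1r ve scalerBl scale1r.
  rewrite (vo (fun j => e j u - 1)) mulr_suml; apply: eq_bigr => j _.
  case: ifPn => [/eqP->|_]; last by rewrite mulrC mulrA.
  by rewrite /sqnorm (ip0l ipP) !(mul0r, mulr0).
rewrite ler_pdivrMr //.
set rho := nrm (pi u x - x).
have uz : nrm (pi u z - z) <= rho + 6 * eps.
  have := nrm_tri ipP (pi u x) (pi u z) z; have := nrm_tri ipP x (pi u x) z.
  by rewrite -(linB (pi_lin piP u)) (pi_nrm piP) (nrmC ipP z x) -/rho; lra.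
have r0 : 0 <= rho + 6 * eps by rewrite addr_ge0 ?nrm_ge0 // mulr_ge0 ?ltW.
move: uz; rewrite (nrm_le_sqr ipP _ r0); have := sqr_ge0 (rho + 6 * eps).
move: ((rho + 6 * eps) ^+ 2) (n2 (pi u z - z)) (n2 z) n2z => s b q q4 s0 bs.
have := ler_wpM2l s0 q4; lra.
Qed.

End EigenMeasure.

(** * Baire's theorem in locally compact groups *)

Section Baire.
Variable G : topologicalZmodType.
Hypothesis G_lc : locally_compact [set: G].

Lemma closed_nbhs_inside (x : G) (O : set G) : nbhs x O ->
  exists K, [/\ nbhs x K, closed K & K `<=` O].
Proof.
move=> nO; have [V [nV V0 VN VV]] := nbhs0_symm (nbhs_unshift nO).
pose S := [set y | V (y - x)]; exists (closure S); split.
- by apply: filterS (nbhs_shift x nV) => y Vy; apply: subset_closure.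
- exact: closed_closure.
move=> y /(_ _ (nbhs_shift y nV)) [z [Sz /= Vz]].
by have := VV _ _ Sz (VN _ Vz); rewrite opprB addrAC subrK addrC subrK.
Qed.

(** If no [F n] had interior, one could choose nested closed sets with interior inside a compact
    [K0], successively missing each [F n]; a common point lies in no [F n]. *)
Lemma baire_locally_compact (F : nat -> set G) : (forall n, closed (F n)) ->
  (forall x, exists n, F n x) -> exists n (x : G), nbhs x (F n).
Proof.
move=> Fcl Fcov; apply: contrapT => Fno.
have {}Fno n (x : G) : ~ nbhs x (F n) by move=> nF; apply: Fno; exists n, x.
(* The conditions on [K] stand under the existential so that [choice] gives a total function
   [nextK]. *)
have step n (K : set G) : exists K' : set G, (exists x : G, nbhs x K) -> closed K ->
    [/\ exists x : G, nbhs x K', closed K', K' `<=` K & K' `&` F n = set0].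
  have [[x nK]|nn] := pselect (exists x : G, nbhs x K); last by exists K.
  have [y [Ky nFy]] : exists y, K^° y /\ ~ F n y.
    apply: contrapT => ny; apply: (Fno n x); apply: filterS (nbhs_interior nK) => y Ky.
    by apply: contrapT => nF; apply: ny; exists y.
  have nO : nbhs y (K^° `&` ~` F n).
    apply: open_nbhs_nbhs; split => //; apply: openI; first exact: open_interior.
    exact: closed_openC.
  have [K' [nK' cK' sK']] := closed_nbhs_inside nO.
  exists K' => _ _; split => //; first by exists y.
    by move=> z /sK'[/interior_subset].
  by rewrite -subset0 => z [/sK'[_ nF] /nF].
have /choice[nextK nextP] (nK : nat * set G) := step nK.1 nK.2.
have [K0] := G_lc (x := 0) I; rewrite withinET => nK0 [cK0 clK0].
pose K := fix K n := if n is n'.+1 then nextK (n', K n') else K0.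
have KP n : (exists x : G, nbhs x (K n)) /\ closed (K n).
  elim: n => [|n [IHn IHc]] /=; first by split => //; exists 0.
  by have [] := nextP (n, K n) IHn IHc.
have Kdec n : K n.+1 `<=` K n by have [] := nextP (n, K n) (KP n).1 (KP n).2.
have Kle m n : (m <= n)%N -> K n `<=` K m.
  elim: n => [|n IHn]; first by rewrite leqn0 => /eqP->.
  by rewrite leq_eqVlt => /orP[/eqP->//|/IHn h x /Kdec/h].
pose Fl : set_system G := [set A | exists n, K n `<=` A].
have FlP : ProperFilter Fl.
  apply: Build_ProperFilter_ex.
    move=> A [n KA]; have [[x nK] _] := KP n.
    by exists x; apply: KA; apply: nbhs_singleton nK.
  split; first by exists 0%N.
    move=> A B [n KA] [m KB]; exists (maxn n m) => x Kx; split.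
      by apply: KA; apply: Kle Kx; apply: leq_maxl.
    by apply: KB; apply: Kle Kx; apply: leq_maxr.
  by move=> A B AB [n KA]; exists n; apply: subset_trans AB.
have FlK0 : Fl K0 by exists 0%N.
have [p [_ clp]] := cK0 Fl FlP FlK0.
have [n Fnp] := Fcov p.
(* The set chosen to miss [F n] is [K n.+1], and it is closed. *)
have Kp : K n.+1 p.
  by apply: (KP n.+1).2 => B nB; apply: clp => //; exists n.+1.
have [_ _ _ K0n] := nextP (n, K n) (KP n).1 (KP n).2.
have : (nextK (n, K n) `&` F (n, K n).1) p by [].
by rewrite K0n.
Qed.

End Baire.

(** * Uniform smallness near 0 *)

Section SmallNeighbourhood.
Variables (R : realType) (G : topologicalZmodType).
Hypothesis G_lc : locally_compact [set: G].

Lemma character_mean_closed (m : fmeas R (G -> R[i])) (r : R) : fm_prob m ->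
  (forall i, is_character (fm_pt m i)) ->
  closed [set u | fm_E m (fun X => cmod (X u - 1)) <= r].
Proof.
move=> mp mchar u ucl; rewrite /= leNgt; apply/negP => ru.
pose s := (fm_E m (fun X => cmod (X u - 1)) - r) / 2.
have s0 : 0 < s by rewrite divr_gt0 // subr_gt0.
have : \forall v \near u, forall i : fm_idx m, cmod (fm_pt m i v - fm_pt m i u) < s.
  apply: filter_forall => i; have [_ [_ /(_ u s s0)]] := mchar i.
  by apply: filterS => v; rewrite normC_cmod ltcR.
move=> /ucl [v [/= vr vs]].
have : fm_E m (fun X => cmod (X u - 1)) <= fm_E m (fun X => cmod (X v - 1)) + s.
  rewrite -[X in _ <= _ + X](fm_E_cst s mp) -fm_ED; apply: fm_E_le => // i.
  have := cmod_tri (fm_pt m i u) (fm_pt m i v) 1; have := vs i.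
  by rewrite cmodC; lra.
by move: ru; rewrite /s; lra.
Qed.

(** The points where all bounds from index [n] on hold form a closed set, and these sets cover [G];
    by Baire one of them is a neighbourhood of some [x]. Passing from [u + x] and [x] to [u] doubles
    the bound. *)
Lemma equicontinuous_means (m : nat -> fmeas R (G -> R[i])) (W : nat -> set G)
    (b : nat -> R) :
  (forall n, fm_prob (m n)) -> (forall n i, is_character (fm_pt (m n) i)) ->
  (forall n, W n `<=` W n.+1) -> \bigcup_n W n = setT ->
  (forall n u, W n u -> fm_E (m n) (fun X => cmod (X u - 1)) <= b n) ->
  exists n0 U, nbhs 0 U /\ forall n u, (n0 <= n)%N -> U u ->
    fm_E (m n) (fun X => cmod (X u - 1)) <= 2 * b n.
Proof.
move=> mp mchar Winc Wcov mW.
have Wle k n : (k <= n)%N -> W k `<=` W n.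
  elim: n => [|n IHn]; first by rewrite leqn0 => /eqP->.
  by rewrite leq_eqVlt => /orP[/eqP->//|/IHn h x /h/Winc].
pose F n := \bigcap_(k in [set k | (n <= k)%N]) [set u | fm_E (m k) (fun X => cmod (X u - 1)) <= b k].
have [||n0 [x nx]] := @baire_locally_compact G G_lc F.
- by move=> n; apply: closed_bigI => k _; apply: character_mean_closed.
- move=> x; have [n _ Wx] : (\bigcup_n W n) x by rewrite Wcov.
  by exists n => k nk; apply: mW; apply: Wle Wx.
exists n0, [set u | F n0 (u + x)]; split; first exact: nbhs_unshift.
move=> n u n0n uF.
have ux := uF n n0n; have x0 := nbhs_singleton nx n n0n; rewrite /= in ux x0.
rewrite mulr_natl mulr2n; apply: le_trans (lerD ux x0).
rewrite -fm_ED; apply: fm_E_le => // i; set X := fm_pt (m n) i.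
have [X1 [XD _]] : is_character X := mchar n i; have cX1 v : cmod (X v) = 1.
  by have := X1 v; rewrite normC_cmod => -[].
have -> : cmod (X u - 1) = cmod (X (u + x) - X x).
  by rewrite XD -{2}[X x]mul1r -mulrBl cmodM cX1 mulr1.
by rewrite (le_trans (cmod_tri _ 1 _)) // [cmod (1 - _)]cmodC.
Qed.

End SmallNeighbourhood.

(** * Random products of characters *)

Section RandomProduct.
Variables (R : realType) (G : topologicalZmodType).

Definition circle_hom (X : G -> R[i]) :=
  (forall x, cmod (X x) = 1) /\ (forall x y, X (x + y) = X x * X y).

Lemma character_circle_hom X : is_character X -> circle_hom X.
Proof.
by move=> [X1 [XD _]]; split => // x; have := X1 x; rewrite normC_cmod => -[].
Qed.

(* Only the atom [ek] of [mu] is multiplied by a random character of law [m]; at the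
   other points the weights of [m] are idle and sum to 1. *)
Definition twist (mu : fmeas R (G -> R[i])) (ek : G -> R[i]) (m : fmeas R (G -> R[i])) :=
  @FMeas R (G -> R[i]) (fm_idx mu * fm_idx m)%type
    (fun p => fm_wt mu p.1 * fm_wt m p.2)
    (fun p => if `[< fm_pt mu p.1 = ek >] then fun x => fm_pt mu p.1 x * fm_pt m p.2 x
              else fm_pt mu p.1).

Lemma twist_prob mu ek m : fm_prob mu -> fm_prob m -> fm_prob (twist mu ek m).
Proof.
move=> [mu0 mu1] [m0 m1]; split=> [[i j]|] /=; first by rewrite mulr_ge0.
rewrite -(pair_big xpredT xpredT (fun i j => fm_wt mu i * fm_wt m j)) /= -[RHS]mu1.
by apply: eq_bigr => i _; rewrite -mulr_sumr m1 mulr1.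
Qed.

Lemma twist_circle_hom mu ek m : (forall i, circle_hom (fm_pt mu i)) ->
  (forall i, circle_hom (fm_pt m i)) -> forall i, circle_hom (fm_pt (twist mu ek m) i).
Proof.
move=> muX mX [i j] /=; case: asboolP => // _.
have [X1 XD] := muX i; have [Y1 YD] := mX j.
split=> [x|x y]; first by rewrite cmodM X1 Y1 mulr1.
by rewrite XD YD mulrACA.
Qed.

(** [dlt] bounds the increase of [psi] under multiplication by a random factor, so one step raises
    the mean of [psi] by at most the mean of [dlt]. *)
Lemma twist_E mu ek m (psi dlt : (G -> R[i]) -> R) : fm_prob mu -> fm_prob m ->
  (forall i, circle_hom (fm_pt mu i)) -> (forall X, 0 <= dlt X) ->
  (forall X Y, circle_hom X -> psi (fun x => X x * Y x) <= psi X + dlt Y) ->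
  fm_E (twist mu ek m) psi <= fm_E mu psi + fm_E m dlt.
Proof.
move=> [mu0 mu1] [m0 m1] muX dlt0 psi_le.
apply: le_trans (_ : \sum_(p : fm_idx mu * fm_idx m) (fm_wt mu p.1 * fm_wt m p.2) *
    (psi (fm_pt mu p.1) + dlt (fm_pt m p.2)) <= _).
  apply: ler_sum => -[i j] _ /=; rewrite ler_wpM2l ?mulr_ge0 //.
  by case: asboolP => _; [apply: psi_le|rewrite lerDl].
rewrite -(pair_big xpredT xpredT (fun i j => (fm_wt mu i * fm_wt m j) *
    (psi (fm_pt mu i) + dlt (fm_pt m j)))) /=.
rewrite le_eqVlt; apply/orP; left; apply/eqP.
transitivity (\sum_i (fm_wt mu i * psi (fm_pt mu i) + fm_wt mu i * fm_E m dlt)).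
  apply: eq_bigr => i _; rewrite mulr_sumr -[X in X + _]mulr1 -m1 mulr_sumr -big_split.
  by apply: eq_bigr => j _ /=; ring.
by rewrite big_split -mulr_suml mu1 mul1r.
Qed.

(* A Lipschitz substitute for the event that [X] is close to [ek] on [H]. *)
Fixpoint gap (ek : G -> R[i]) (r : R) (H : seq G) (X : G -> R[i]) : R :=
  if H is h :: H' then Num.min (Num.max 0 (r - cmod (X h - ek h))) (gap ek r H' X) else r.

Lemma gap_ge ek r c H X : c <= r ->
  (forall h, h \in H -> cmod (X h - ek h) <= r - c) -> c <= gap ek r H X.
Proof.
move=> cr; elim: H => //= h H IHH XH; rewrite le_min; apply/andP; split.
  by rewrite le_max; apply/orP; right; have := XH h (mem_head _ _); lra.
by apply: IHH => h' h'H; apply: XH; rewrite in_cons h'H orbT.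
Qed.

Lemma gap_ge0 ek r H X : 0 <= r -> 0 <= gap ek r H X.
Proof.
by move=> r0; elim: H => //= h H IHH; rewrite le_min IHH andbT le_max lexx.
Qed.

Lemma gap_le0 ek r H X h : h \in H -> r <= cmod (X h - ek h) -> gap ek r H X <= 0.
Proof.
move=> + Xh; elim: H => //= a H IHH; rewrite in_cons ge_min => /orP[/eqP<-|/IHH->].
  by rewrite ge_max lexx subr_le0 Xh.
by rewrite orbT.
Qed.

Lemma gap_mul ek r H (X Y : G -> R[i]) : circle_hom X ->
  gap ek r H (fun x => X x * Y x) <= gap ek r H X + \sum_(h <- H) cmod (Y h - 1).
Proof.
move=> [X1 _]; elim: H => [|h H IHH] /=; first by rewrite big_nil addr0.
rewrite big_cons; set S := \sum_(_ <- _) _ in IHH *.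
have S0 : 0 <= S by apply: sumr_ge0 => i _; apply: cmod_ge0.
set t := cmod (Y h - 1); have t0 : 0 <= t := cmod_ge0 _.
have Xt : cmod (X h - ek h) <= cmod (X h * Y h - ek h) + t.
  have -> : X h - ek h = (X h * Y h - ek h) - X h * (Y h - 1) by ring.
  by rewrite (le_trans (cmodB _ _)) // cmodM X1 mul1r.
rewrite -lerBlDr le_min; apply/andP; split; rewrite lerBlDr ge_min.
  apply/orP; left; rewrite ge_max; apply/andP; split.
    by rewrite !addr_ge0 // le_max lexx.
  have : r - cmod (X h - ek h) <= Num.max 0 (r - cmod (X h - ek h)) by rewrite le_max lexx orbT.
  lra.
by apply/orP; right; lra.
Qed.

Hypothesis G_lc : locally_compact [set: G].
Variables (e : nat -> G -> R[i]) (g : nat -> G).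
Hypothesis Hces : forall chi : G -> R[i], is_character chi ->
  (exists n, chi = e n) \/ cesaro_to_0 g chi.

Lemma half_pow_small (t : R) : 0 < t -> exists n0, forall n, (n0 <= n)%N -> 2^-1 ^+ n <= t.
Proof.
move=> t0; have [n0 n0P] := small_index 1 t0; exists n0 => n /n0P; apply: le_trans.
rewrite mul1r exprVn lef_pV2 ?posrE ?ltr0n ?exprn_gt0 // -natrX ler_nat.
exact: ltn_expl.
Qed.

Lemma lower_bound (I : finType) (a : I -> R) : (forall i, 0 < a i) ->
  exists2 c, 0 < c & forall i, c <= a i.
Proof.
move=> a0; have S0 : 0 < \sum_i (a i)^-1 + 1.
  by rewrite ltr_wpDl // sumr_ge0 // => i _; rewrite invr_ge0 ltW.
exists (\sum_i (a i)^-1 + 1)^-1 => [|i]; first by rewrite invr_gt0.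
rewrite -[leRHS]invrK lef_pV2 ?posrE ?invr_gt0 // (bigD1 i) //= -addrA lerDl.
by rewrite addr_ge0 // sumr_ge0 // => j _; rewrite invr_ge0 ltW.
Qed.

Section Contradiction.
Variables (m : nat -> fmeas R (G -> R[i])) (W : nat -> set G).
Hypothesis mp : forall n, fm_prob (m n).
Hypothesis mchar : forall n i, is_character (fm_pt (m n) i) /\ exists h, fm_pt (m n) i h <> 1.
Hypothesis Winc : forall n, W n `<=` W n.+1.
Hypothesis Wcov : \bigcup_n W n = setT.
Local Notation mean n u := (fm_E (m n) (fun X => cmod (X u - 1))).
Hypothesis mW : forall n u, W n u -> mean n u <= 2^-1 ^+ n.
Hypothesis mg : forall n k, mean n (g k) <= 2^-1 ^+ n.

(** The current law, together with the pairs [(H, r)] recorded so far: each says that, when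
    recorded, the law was at distance [r] from some [e l] on [H]. *)
Let state := (fmeas R (G -> R[i]) * seq (seq G * R))%type.

Let inv (s : state) := [/\ fm_prob s.1, forall i, circle_hom (fm_pt s.1 i) &
  forall c, c \in s.2 -> 0 < c.2].

(** The perturbation allowed at step [l]; the total over all steps is 1/32. *)
Let kap l : R := 1 / 64 / 2 ^+ l.

Let kap_gt0 l : 0 < kap l.
Proof. by rewrite !divr_gt0 // exprn_gt0. Qed.

Let eventually_small (H : seq G) (t : R) : 0 < t ->
  exists n0, forall n, (n0 <= n)%N -> \sum_(h <- H) mean n h <= t.
Proof.
have Wle k n : (k <= n)%N -> W k `<=` W n.
  elim: n => [|n IHn]; first by rewrite leqn0 => /eqP->.
  by rewrite leq_eqVlt => /orP[/eqP->//|/IHn h x /h/Winc].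
elim: H t => [|h H IHH] t t0; first by exists 0%N => n _; rewrite big_nil ltW.
have t2 : 0 < t / 2 by rewrite divr_gt0.
have [n1 n1P] := IHH _ t2; have [n2 n2P] := half_pow_small t2.
have [k _ Wk] : (\bigcup_n W n) h by rewrite Wcov.
exists (maxn k (maxn n1 n2)) => n; rewrite !geq_max => /and3P[kn n1n n2n].
rewrite big_cons; have := n1P n n1n; have := n2P n n2n.
have := mW (Wle _ _ kn _ Wk); lra.
Qed.

Let eventually_small_all (s : seq (seq G * R)) (t : R) : 0 < t ->
  (forall c, c \in s -> 0 < c.2) ->
  exists n0, forall n, (n0 <= n)%N ->
    forall c, c \in s -> \sum_(h <- c.1) mean n h <= c.2 * t.
Proof.
move=> t0; elim: s => [|a s IHs] sP; first by exists 0%N.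
have [|n1 n1P] := IHs; first by move=> c cs; apply: sP; rewrite in_cons cs orbT.
have [n2 n2P] := @eventually_small a.1 (a.2 * t) (mulr_gt0 (sP a (mem_head _ _)) t0).
exists (maxn n1 n2) => n; rewrite geq_max => /andP[n1n n2n] c.
by rewrite in_cons => /orP[/eqP->|/n1P]; [apply: n2P|apply].
Qed.

Section Chain.
Variables (n0 : nat) (U : set G).
Hypothesis U_small : forall n u, (n0 <= n)%N -> U u -> mean n u <= 2 * 2^-1 ^+ n.

Let stepped l (s s' : state) := exists n (H : seq G) (r : R),
  [/\ s' = (twist s.1 (e l) (m n), (H, r) :: s.2),
      forall i, exists2 h, h \in H & r <= cmod (fm_pt s'.1 i h - e l h),
      forall u, U u -> mean n u <= kap l,
      forall k, mean n (g k) <= kap l &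
      forall c, c \in s.2 -> \sum_(h <- c.1) mean n h <= c.2 * kap l].

(** For large [n] the law [m n] disturbs [U], the [g k] and all recorded pairs by little. After the
    twist no atom equals [e l]: either it differed before, or it is [e l] times a nontrivial
    character. As there are finitely many atoms, a common distance [r] exists. *)
Lemma step_ex l s : exists s', inv s -> inv s' /\ stepped l s s'.
Proof.
have [[sp sX sc]|ns] := pselect (inv s); last by exists s.
have [n1 n1P] := eventually_small_all (kap_gt0 l) sc.
have k2 : 0 < kap l / 2 by rewrite divr_gt0.
have [n2 n2P] := half_pow_small k2.
pose n := maxn n0 (maxn n1 n2).
have n0n : (n0 <= n)%N by rewrite leq_maxl.
have n1n : (n1 <= n)%N by rewrite /n !leq_max leqnn orbT.
have n2n : (n2 <= n)%N by rewrite /n !leq_max leqnn !orbT.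
have mX i : circle_hom (fm_pt (m n) i) := character_circle_hom (mchar i).1.
pose mu := twist s.1 (e l) (m n).
have /choice[h hP] i : exists h, fm_pt mu i h <> e l h.
  case: i => i j /=; case: asboolP => [<-|ne].
    have [h h1] := (mchar j).2; exists h => /eqP.
    rewrite -subr_eq0 -[X in _ - X]mulr1 -mulrBr mulf_eq0 subr_eq0 => /orP[/eqP X0|/eqP//].
    by have := (sX i).1 h; rewrite X0 cmod0 => /eqP; rewrite eq_sym oner_eq0.
  by apply: contrapT => nh; apply: ne; apply/funext => h; apply: contrapT => hh; apply: nh; exists h.
have [i|r r0 rP] := @lower_bound _ (fun i => cmod (fm_pt mu i (h i) - e l (h i))).
  rewrite lt_def cmod_ge0 andbT; apply/negP => /eqP/cmod_eq0/eqP.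
  by rewrite subr_eq0 => /eqP/hP.
exists (mu, ([seq h i | i : fm_idx mu], r) :: s.2) => _; split.
  split => /=; first exact: twist_prob.
    exact: twist_circle_hom.
  by move=> c; rewrite in_cons => /orP[/eqP->//|/sc].
exists n, [seq h i | i : fm_idx mu], r; split => //.
- by move=> i; exists (h i); [apply/mapP; exists i; rewrite ?mem_enum|apply: rP].
- by move=> u /(U_small n0n); have := n2P n n2n; lra.
- move=> k; rewrite (le_trans (mg n k)) // (le_trans (n2P n n2n)) //.
  by rewrite ler_pdivrMr // ler_peMr ?ltW // ltr1n.
- exact: n1P.
Qed.

(** A limit of the laws along the chain fulfils the hypotheses of [character_of_content] with
    [theta = eta = 1 / 2], and the character obtained contradicts [Hces]. *)
Lemma chain_absurd : nbhs 0 U -> False.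
Proof.
move=> nU; have /choice[nxt nxtP] (ls : nat * state) := step_ex ls.1 ls.2.
pose s0 : state := (@FMeas R (G -> R[i]) unit (fun=> 1) (fun _ _ => 1), [::]).
pose S := fix S l := if l is l'.+1 then nxt (l', S l') else s0.
have invS l : inv (S l).
  elim: l => [|l IHl]; last by have [] := nxtP (l, S l) IHl.
  split => //=; first by split => //=; rewrite big_const card_unit /= addr0.
  by move=> _; split => *; rewrite ?cmod1 ?mulr1.
have stepS l : stepped l (S l) (S l.+1) by have [] := nxtP (l, S l) (invS l).
(* One estimate for two uses: [c] supported in [U] gives concentration near 1, and [c] uniform on
   initial terms of [g] keeps the Cesaro means near 1. *)
have near1 (c : fmeas R G) : fm_prob c ->
    (forall i, U (fm_pt c i) \/ exists k, fm_pt c i = g k) ->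
    forall l, fm_E (S l).1 (fun X => cmod (fm_C c X - 1)) <= 1 / 64 * (2 - 2 / 2 ^+ l).
  move=> cp cU; elim=> [|l IHl].
    rewrite expr0 divr1 subrr mulr0 /fm_E /= big_const card_unit /= addr0.
    by rewrite (fm_C_cst _ cp) subrr cmod0 mulr0.
  have [n [H [r [-> _ nU' ng _]]]] := stepS l; have [sp sX _] := invS l.
  have := @twist_E (S l).1 (e l) (m n) (fun X => cmod (fm_C c X - 1))
    (fun Y => fm_E c (fun u => cmod (Y u - 1))) sp (mp n) sX.
  have -> : fm_E (m n) (fun Y => fm_E c (fun u => cmod (Y u - 1))) =
      fm_E c (fun u => mean n u).
    rewrite /fm_E; under eq_bigr do rewrite mulr_sumr.
    rewrite exchange_big; apply: eq_bigr => i _ /=; rewrite mulr_sumr.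
    by apply: eq_bigr => j _; rewrite mulrCA.
  have : fm_E c (fun u => mean n u) <= kap l.
    rewrite -(fm_E_cst (kap l) cp); apply: fm_E_le => // i.
    by have [/nU'|[k ->]] := cU i.
  have -> : 1 / 64 * (2 - 2 / 2 ^+ l.+1) = 1 / 64 * (2 - 2 / 2 ^+ l) + kap l.
    by rewrite exprS /kap; field; rewrite expf_neq0.
  move=> h1 /(_ _ _) h2; apply: le_trans (h2 _ _) (lerD IHl h1).
    by move=> Y; apply: fm_E_ge0 => // u; apply: cmod_ge0.
  move=> X Y [X1 _].
  have -> : fm_C c (fun x => X x * Y x) - 1 =
    (fm_C c X - 1) + (fm_C c (fun x => X x * Y x) - fm_C c X) by ring.
  rewrite (le_trans (cmodD _ _)) // lerD2l fm_CB (le_trans (fm_C_cmod _ cp)) //.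
  by apply: fm_E_le => // i; rewrite -{2}[X _]mulr1 -mulrBr cmodM X1 mul1r.
(* Just after step [j] the mean of the gap from [e j] is 0; each later step [l] adds at most
   [r * kap l]. *)
have avoid j : exists (H : seq G) (r : R), 0 < r /\ forall l, (j < l)%N ->
    fm_E (S l).1 (gap (e j) r H) <= r * (1 / 64 * (2 / 2 ^+ j.+1 - 2 / 2 ^+ l)).
  have [n [H [r [Sj far _ _ _]]]] := stepS j; exists H, r.
  have r0 : 0 < r by have [_ _] := invS j.+1; rewrite Sj /= => /(_ (H, r)); apply; apply: mem_head.
  split=> //; suff cons d : (H, r) \in (S (j.+1 + d)%N).2 /\
      fm_E (S (j.+1 + d)%N).1 (gap (e j) r H) <=
        r * (1 / 64 * (2 / 2 ^+ j.+1 - 2 / 2 ^+ (j.+1 + d))).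
    by move=> l /subnKC <-; have [] := cons (l - j.+1)%N.
  elim: d => [|d [IHc IHd]].
    rewrite addn0 subrr !mulr0; split; first by rewrite Sj mem_head.
    have [sp _ _] := invS j.+1.
    rewrite -(fm_E_cst 0 sp); apply: fm_E_le => // i.
    by have [h hH hr] := far i; apply: gap_le0 hH hr.
  rewrite addnS; set l := (j.+1 + d)%N in IHc IHd *.
  have [n' [H' [r' [Sl _ _ _ small]]]] := stepS l; have [sp sX _] := invS l.
  split; first by rewrite Sl in_cons IHc orbT.
  have h1 : fm_E (m n') (fun Y => \sum_(h <- H) cmod (Y h - 1)) <= r * kap l.
    apply: le_trans (small _ IHc); rewrite le_eqVlt; apply/orP; left; apply/eqP.
    rewrite /fm_E; under eq_bigr do rewrite mulr_sumr.
    by rewrite exchange_big.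
  have -> : r * (1 / 64 * (2 / 2 ^+ j.+1 - 2 / 2 ^+ l.+1)) =
      r * (1 / 64 * (2 / 2 ^+ j.+1 - 2 / 2 ^+ l)) + r * kap l.
    by rewrite [2 ^+ l.+1]exprS /kap; field; rewrite !expf_neq0.
  apply: le_trans (lerD IHd h1); rewrite Sl.
  apply: twist_E => // [Y|X Y XC]; last exact: gap_mul.
  by apply: sumr_ge0 => h _; apply: cmod_ge0.
have pow_le l : 1 / 64 * (2 - 2 / 2 ^+ l) <= 1 / 32 :> R.
  have : 0 <= 2 / 2 ^+ l :> R by rewrite divr_ge0 // exprn_ge0.
  by move: (2 / 2 ^+ l) => a; lra.
have Sp l : fm_prob (S l).1 by have [] := invS l.
have [p [pC p_le p_ge]] := @limit_content R _ nat \oo _ (fun l => (S l).1) Sp.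
have [] := @character_of_content R G G_lc p (1 / 2) (1 / 2) e g pC; rewrite ?divr_gt0 //.
- apply: p_le; exists 0%N => // l _ /=; rewrite /fm_P /fm_E big1 // => i _.
  have [_ sX _] := invS l.
  by rewrite asboolF ?mulr0 // => -[x]; rewrite (sX i).1 eqxx.
- move=> a b r r0; apply: p_le; exists 0%N => // l _ /=; rewrite /fm_P /fm_E big1 // => i _.
  have [_ sX _] := invS l.
  by rewrite asboolF ?mulr0 //= (sX i).2 subrr cmod0 leNgt r0.
- exists U => // c cp cU; apply: p_le; exists 0%N => // l _ /=.
  have := @fm_markov R _ (S l).1 [set X | 1 / 2 <= cmod (fm_C c X - 1)]
    (fun X => cmod (fm_C c X - 1)) (1 / 2) (Sp l) (fun X => cmod_ge0 _) (fun i Ai => Ai).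
  have := near1 c cp (fun i => or_introl (cU i)) l; have := pow_le l; lra.
- move=> j _; have [H [r [r0 HP]]] := avoid j.
  exists H, (r / 2); split; first by rewrite divr_gt0.
  apply: p_le; exists j.+1 => // l jl /=.
  have := @fm_markov R _ (S l).1 [set X | forall h, h \in H -> cmod (X h - e j h) < r / 2]
    (gap (e j) r H) (r / 2) (Sp l) (fun X => gap_ge0 _ _ _ (ltW r0)).
  have gap_half i : (forall h, h \in H -> cmod (fm_pt (S l).1 i h - e j h) < r / 2) ->
      r / 2 <= gap (e j) r H (fm_pt (S l).1 i).
    move=> Xh; apply: gap_ge => [|h hH]; first lra.
    by have := Xh h hH; lra.
  move=> /(_ gap_half)/le_trans/(_ (HP l jl)).
  set P := fm_P _ _; have -> : r / 2 * P = r * (P / 2) by ring.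
  rewrite ler_pM2l // => PE.
  have : 0 <= 2 / 2 ^+ l :> R by rewrite divr_ge0 // exprn_ge0.
  have -> : 1 / 2 / 16 / 2 ^+ j = 2 * (1 / 64 * (2 / 2 ^+ j.+1)) :> R.
    by rewrite exprS; field; rewrite expf_neq0.
  by move: (2 / 2 ^+ l) (2 / 2 ^+ j.+1) PE => a b; lra.
- move=> n; pose N := n.+1; exists N; first exact: leqnSn.
  pose c := @FMeas R G 'I_N (fun=> N%:R^-1) (fun k : 'I_N => g k).
  have cp : fm_prob c.
    split=> [k|] /=; first by rewrite invr_ge0.
    by rewrite sumr_const card_ord -[_ *+ _]mulr_natl divff // pnatr_eq0.
  have cE X : fm_C c X = cesaro g N X.
    rewrite /fm_C /cesaro mulr_sumr; apply: eq_bigr => k _ /=.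
    by rewrite fmorphV rmorph_nat.
  apply: p_ge; exists 0%N => // l _ /=.
  have cU k : U (fm_pt c k) \/ exists k', fm_pt c k = g k' by right; exists k.
  have := near1 c cp cU l; have := pow_le l.
  set E := fm_E _ _; set A := [set X | _ <= _].
  have : 1 <= fm_P (S l).1 A + 2 * E.
    rewrite -[leLHS](fm_E_cst 1 (Sp l)) /E -fm_EZ -fm_ED; apply: fm_E_le => // i.
    have [Ai|nA] := asboolP (A _); first by rewrite /= lerDl mulr_ge0 ?cmod_ge0.
    set X := fm_pt _ i in nA *.
    have : cmod (cesaro g N X) < 1 / 2 by rewrite ltNge; apply/negP => hX; apply: nA; exact: hX.
    rewrite cE /= mulr0n add0r; have := cmodB (cesaro g N X) (cesaro g N X - 1).
    rewrite subKr cmod1; lra.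
  lra.
- move=> chi [chiC nE nC]; have [[j /nE//]|//] := Hces chiC.
Qed.

End Chain.

Lemma random_product_absurd : False.
Proof.
have [n0 [U [nU Usmall]]] :=
  equicontinuous_means G_lc mp (fun n i => (mchar i).1) Winc Wcov mW.
exact: chain_absurd Usmall nU.
Qed.

End Contradiction.

End RandomProduct.

(** * Kazhdan sets and generating sets *)

Section Kazhdan.
Variables (R : realType) (G : topologicalZmodType).

Section NonKazhdan.
Hypothesis G_lc : locally_compact [set: G].
Variables (e : nat -> G -> R[i]) (g : nat -> G).
Hypothesis Hces : forall chi : G -> R[i], is_character chi ->
  (exists n, chi = e n) \/ cesaro_to_0 g chi.

(** A representation showing that [eps] fails for [Q] is fed, with its vector normalised, to
    [eigen_measure]. The variance inequality passes from squares to first moments, and [14 * eps] is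
    the square root of [4 * (eps + 6 * eps) ^+ 2]. *)
Lemma non_kazhdan_measure (Q : set G) (eps : R) : 0 < eps -> eps <= 1 / 12 ->
  (forall k, Q (g k)) -> ~ kazhdan_set R Q ->
  exists m : fmeas R (G -> R[i]), [/\ fm_prob m,
    forall i, is_character (fm_pt m i) /\ exists h, fm_pt m i h <> 1 &
    forall u, Q u -> fm_E m (fun X => cmod (X u - 1)) <= 14 * eps].
Proof.
move=> eps0 eps12 Qg nQ; apply: contrapT => nm; apply: nQ; exists eps; split => //.
move=> V ip pi ipH piP x [d [dx xd]]; apply: contrapT => noinv.
have ipP := ipH.1; apply: nm.
have d0 : 0 <= d by rewrite (le_trans _ (xd _ (Qg 0%N))) // nrm_ge0.
have x0 : 0 < ipnorm ip x by rewrite -(pmulr_rgt0 _ eps0) (le_lt_trans d0).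
pose a : R[i] := (ipnorm ip x)^-1%:C.
have ca : cmod a = (ipnorm ip x)^-1 by rewrite cmod_real ger0_norm // invr_ge0 nrm_ge0.
have ax u : ipnorm ip (pi u (a *: x) - a *: x) = ipnorm ip (pi u x - x) / ipnorm ip x.
  by rewrite (linZ (pi_lin piP u)) -scalerBr (nrmZ ipP) ca mulrC.
have axQ u : Q u -> ipnorm ip (pi u (a *: x) - a *: x) <= eps.
  by move=> Qu; rewrite ax ler_pdivrMr // (le_trans (xd u Qu)) // ltW.
have [||m [mp mchar mE]] := eigen_measure G_lc Hces ipH piP _ eps0 eps12
  (fun k => axQ _ (Qg k)) _ (x := a *: x).
- by rewrite (n2Z ipP) ca -(nrm_sqr ipP) -exprMn mulVf ?expr1n // gt_eqF.
- by move=> v vinv; apply: contrapT => v0; apply: noinv; exists v.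
exists m; split => // u Qu.
have := le_trans (fm_E_sqr _ mp) (mE u).
set M := fm_E _ _ => ME.
have M0 : 0 <= M by apply: fm_E_ge0 => // X; apply: cmod_ge0.
rewrite -(@ler_pXn2r _ 2) ?nnegrE ?mulr_ge0 ?(ltW eps0) // (le_trans ME) //.
have -> : (14 * eps) ^+ 2 = 4 * (eps + 6 * eps) ^+ 2 by ring.
rewrite ler_pM2l // ler_pXn2r ?nnegrE ?addr_ge0 ?mulr_ge0 ?nrm_ge0 ?(ltW eps0) //.
by rewrite lerD2r axQ.
Qed.

Lemma kazhdan_union (W : nat -> set G) : (forall n, W n `<=` W n.+1) ->
  \bigcup_n W n = setT -> exists n, kazhdan_set R (W n `|` range g).
Proof.
move=> Winc Wcov; apply: contrapT => nW.
(* The divisor 16 gives both [eps n <= 1 / 12] and [14 * eps n <= 2^-1 ^+ n]. *)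
pose eps n : R := 2^-1 ^+ n / 16.
have eps0 n : 0 < eps n by rewrite divr_gt0 // exprn_gt0 // invr_gt0.
have eps12 n : eps n <= 1 / 12.
  have : (2^-1 : R) ^+ n <= 1 by rewrite exprn_ile1 // ?invr_ge0 // invf_le1 // ler1n.
  by rewrite /eps; move: (2^-1 ^+ n) => t; lra.
have /choice[m mP] n : exists m : fmeas R (G -> R[i]), [/\ fm_prob m,
    forall i, is_character (fm_pt m i) /\ exists h, fm_pt m i h <> 1 &
    forall u, (W n `|` range g) u -> fm_E m (fun X => cmod (X u - 1)) <= 14 * eps n].
  apply: non_kazhdan_measure => //; first by move=> k; right; exists k.
  by move=> kz; apply: nW; exists n.
have eps_le n : 14 * eps n <= 2^-1 ^+ n.
  have : 0 <= (2^-1 : R) ^+ n by rewrite exprn_ge0 // invr_ge0.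
  by rewrite /eps; move: (2^-1 ^+ n) => t; lra.
apply: (@random_product_absurd R G G_lc e g Hces m W) => //.
- by move=> n; have [] := mP n.
- by move=> n i; have [_ ? _] := mP n.
- move=> n u Wu; have [_ _ mE] := mP n.
  by rewrite (le_trans _ (eps_le n)) // mE //; left.
- move=> n k; have [_ _ mE] := mP n.
  by rewrite (le_trans _ (eps_le n)) // mE //; right; exists k.
Qed.

End NonKazhdan.

Section Generation.
Variables (V : lmodType R[i]) (ip : V -> V -> R[i]) (pi : G -> V -> V).
Hypothesis ipP : is_inner_product ip.
Hypothesis piP : is_unitary_rep ip pi.

Lemma nsum_displacement (P : set G) (x : V) (d : R) : 
  (forall u, P u -> ipnorm ip (pi u x - x) <= d) ->
  forall n u, nsum P n u -> ipnorm ip (pi u x - x) <= n%:R * d.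
Proof.
move=> Pd; elim=> [|n IHn] u /= => [->|[v [w [vn Pw ->]]]].
  by rewrite (pi0 piP) subrr (nrm0 ipP) mul0r.
apply: le_trans (nrm_tri ipP (pi v x) _ _) _.
rewrite (piM piP) -(linB (pi_lin piP v)) (pi_nrm piP) -natr1 mulrDl mul1r addrC.
by rewrite lerD ?IHn ?Pd.
Qed.

Lemma displacement_opp (x : V) u : ipnorm ip (pi (- u) x - x) = ipnorm ip (pi u x - x).
Proof.
rewrite -(pi_nrm piP u (pi (- u) x - x)) (linB (pi_lin piP u)) -(piM piP).
by rewrite subrr (pi0 piP) (nrmC ipP).
Qed.

End Generation.

Section SignedSums.
Variable Q : set G.

(** Including 0 makes the sumsets [nsum signed n] increase with [n]. *)
Let signed : set G := [set u | u = 0 \/ (Q u \/ Q (- u))].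

Lemma nsum_add n k x y : nsum signed n x -> nsum signed k y -> nsum signed (n + k) (x + y).
Proof.
move=> xn; elim: k y => [y /= ->|k IHk y /= [v [w [vk sw ->]]]].
  by rewrite addn0 addr0.
rewrite addnS /=; exists (x + v), w; split => //; first exact: IHk.
by rewrite addrA.
Qed.

Lemma nsum_opp n x : nsum signed n x -> nsum signed n (- x).
Proof.
elim: n x => [x /= ->|n IHn x /= [v [w [vn sw ->]]]]; first by rewrite oppr0.
exists (- v), (- w); split; [exact: IHn| |by rewrite opprD].
case: sw => [->|[qw|qw]]; [left; exact: oppr0|right; right; by rewrite opprK|by right; left].
Qed.

(** A word of length [n] displaces a vector at most [n] times as far as its letters do, so the
    constant is divided by [n.+1], which also covers [Q] itself when [n = 0]. Nonemptiness of [Q]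
    makes [d] nonnegative. *)
Lemma kazhdan_of_nsum n : Q !=set0 ->
  kazhdan_set R (nsum signed n `|` Q) -> kazhdan_set R Q.
Proof.
move=> [q0 Qq0] [eps [eps0 kz]]; exists (eps / n.+1%:R); split; first by rewrite divr_gt0.
move=> V ip pi ipH piP x [d [dx xd]]; apply: (kz V ip pi ipH piP x).
have d0 : 0 <= d by rewrite (le_trans _ (xd _ Qq0)) // nrm_ge0.
exists (n.+1%:R * d); split.
  by rewrite mulrC -ltr_pdivlMr // mulrAC.
have sd u : signed u -> ipnorm ip (pi u x - x) <= d.
  case=> [->|[/xd//|/xd]]; first by rewrite (pi0 piP) subrr (nrm0 ipH.1).
  by rewrite (displacement_opp ipH.1 piP).
move=> u [/(nsum_displacement ipH.1 piP sd) un|/xd ud].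
  by rewrite (le_trans un) // ler_wpM2r // ler_nat.
by rewrite (le_trans ud) // ler_peMl // ler1n.
Qed.

Lemma nsum_generates : generates Q ->
  (forall n, nsum signed n `<=` nsum signed n.+1) /\ \bigcup_n nsum signed n = setT.
Proof.
move=> genQ; split=> [n u un|].
  by exists u, 0; split; rewrite ?addr0 //; left.
apply: genQ => [|x y [n _ nx] [k _ ky]|x Qx]; first by exists 0%N.
  by exists (n + k)%N => //; apply: nsum_add => //; apply: nsum_opp.
by exists 1%N => //; exists 0, x; split => //; [right; left|rewrite add0r].
Qed.

End SignedSums.

End Kazhdan.

Theorem theorem1 (R : realType) (G : topologicalZmodType)
  (G_hausdorff : hausdorff_space G) (G_lc : locally_compact [set: G])
  (g : nat -> G)
  (Hcesaro : exists e : nat -> (G -> R[i]),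
     forall chi : G -> R[i], is_character chi ->
       (exists n, chi = e n) \/ cesaro_to_0 g chi) :
  (generates (range g) -> kazhdan_set R (range g)) /\
  (forall W : nat -> set G,
     (forall n, W n `<=` W n.+1) -> \bigcup_n W n = setT ->
     exists n, kazhdan_set R (W n `|` range g)).
Proof.
have [e Hces] := Hcesaro.
have main := kazhdan_union G_lc Hces; split=> [gen|]; last exact: main.
(* The second claim is applied to the sets of signed words of length [n], which exhaust [G] because
   [range g] generates it. *)
have [inc cov] := nsum_generates gen; have [n kz] := main _ inc cov.
by apply: kazhdan_of_nsum kz; exists (g 0%N), 0%N.
Qed.
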